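(* Define the integers $a_n$ ($n\ge0$) by the expansion \[ f(z)=\prod_{n=1}^{\infty}\big(1-e^{2\pi i n z}\big)=\sum_{n=0}^{\infty}a_n e^{2\pi i n z},\qquad \operatorname{Im} z>0, \] and for $s>0$ let \[ m_{s,f}(x)=\sum_{n=1}^{\infty}\frac{a_n e^{-2\pi i n x}}{n^s},\qquad x\in[0,1]. \] If $1/4<s<1/2$, then $m_{s,f}$ belongs to weak-type $L^{2/(1-2s)}[0,1]$; that is, there is a constant $c$ such that $|\{x\in[0,1]:|m_{s,f}(x)|>\alpha\}|\le c\,\alpha^{-2/(1-2s)}$ for all $\alpha>0$.
   Context: By Euler's pentagonal number theorem, $a_n\in\{0,\pm1\}$ and $a_n\ne0$ only when $n=(3k^2+k)/2$ for some $k\in\mathbb{Z}$; hence for $s>1/4$ the coefficients $a_n n^{-s}$ are square-summable and the series defining $m_{s,f}$ converges in $L^2[0,1]$. A function $g$ on $[0,1]$ is of weak-type $L^r[0,1]$ ($r>0$) if $|\{x\in[0,1]:|g(x)|>\alpha\}|\le c\,\alpha^{-r}$ for all $\alpha>0$, with $c$ independent of $\alpha$. *)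

(* Defs.v *)
From HB Require Import structures.
From mathcomp Require Import all_boot all_order all_algebra.
From mathcomp Require Import all_classical all_reals all_analysis.
Set Implicit Arguments. Unset Strict Implicit. Unset Printing Implicit Defensive.
Import Order.TTheory GRing.Theory Num.Theory.
Import numFieldNormedType.Exports.
Local Open Scope ring_scope.

(* euler_coef n = a_n : the coefficient of q^n in prod_{k>=1} (1 - q^k).
   Only the factors with k <= n contribute to the coefficient of q^n, so it is
   the n-th coefficient of the polynomial prod_{k=1}^{n} (1 - X^k). *)
Definition euler_coef (n : nat) : int :=
  (\prod_(1 <= k < n.+1) (1 - 'X^k : {poly int}))`_n.

Definition m_re_partial (R : realType) (s : R) (N : nat) (x : R) : R :=
  \sum_(1 <= n < N.+1)
     (euler_coef n)%:~R * cos (2 * pi * n%:R * x) / (n%:R `^ s).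

Definition m_im_partial (R : realType) (s : R) (N : nat) (x : R) : R :=
  \sum_(1 <= n < N.+1)
     - ((euler_coef n)%:~R * sin (2 * pi * n%:R * x) / (n%:R `^ s)).

Definition unit_interval (R : realType) : set R := [set x : R | 0 <= x <= 1].

(* Main.v *)
(** In fact the function is bounded. Up to the factor [q^(1/24)], [f] is the eta function, a cusp
    form of weight 1/2, so [|f(x + iy)| <= C y^(-1/4)], and [n^(-s)] is an average of the
    exponentials [exp (- n y)] against [y^(s-1) dy]; since [s > 1/4], integrating the bound gives
    [|m_{s,f}| <= B] almost everywhere, which is stronger than the weak-type estimate.

    The cusp bound is obtained from [|f|^2] without modular forms. By the pentagonal number
    theorem [f] is a theta series; in the variables [h = k - k'], [J = 3 (k + k') + 1] the double
    sum [|f|^2] is, for each [h], a sum of Gaussians in [J] with a linear phase. Poisson summation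
    in [J] turns it into a sum over the lattice of pairs [(h, l)] of a sign times a Gaussian of
    [h z - l]. On the multiples of a primitive pair the signs are [cos (g pi c / 3)] with [c] odd,
    whose partial sums are bounded (this is the vanishing at the cusps), so each line through
    the origin contributes at most a constant times its first term, and the sum of those over
    the primitive pairs is bounded uniformly in [z] by reduction to a fundamental domain.
    Poisson summation itself is done with binomial coefficients in place of Gaussians, where it
    is a finite identity between trigonometric sums; the Gaussian is recovered in the limit. *)

Require Import Defs.
From HB Require Import structures.
From mathcomp Require Import all_boot all_order all_algebra.
From mathcomp Require Import all_classical all_reals all_analysis.
From mathcomp Require Import measurable_realfun.
From mathcomp Require Import ring lra zify.
Set Implicit Arguments.
Unset Strict Implicit.
Unset Printing Implicit Defensive.
Import Order.TTheory GRing.Theory Num.Theory.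
Import numFieldNormedType.Exports.
Local Open Scope classical_set_scope.
Local Open Scope ring_scope.

(** * The pentagonal number theorem *)

(** The exponents [(3 k^2 + k) / 2] at [k = - j] and, for [pent_pos], at [k = j]; the halves are
    absorbed into binomial coefficients. *)
Definition pent_neg (j : nat) : nat := (j * j + 'C(j, 2))%N.
Definition pent_pos (j : nat) : nat := (j * j + 'C(j.+1, 2))%N.

(** Shanks' finite form of the pentagonal number theorem: raising [n] by one changes the left side
    by a sum that telescopes in [j] and leaves just the two new pentagonal powers. *)
Lemma shanks_identity (A : comPzRingType) (x : A) (n : nat) :
  \sum_(j < n.+1) (-1) ^+ j * (\prod_(j <= i < n) (1 - x ^+ i.+1))
                  * x ^+ (j * n + 'C(j.+1, 2))
  = 1 + \sum_(1 <= j < n.+1) (-1) ^+ j * (x ^+ pent_neg j + x ^+ pent_pos j).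
Proof.
pose t n j := (-1) ^+ j * (\prod_(j <= i < n) (1 - x ^+ i.+1))
                  * x ^+ (j * n + 'C(j.+1, 2)).
rewrite -[LHS]/(\sum_(j < n.+1) t n j).
elim: n => [|n IHn].
  by rewrite big_ord_recl big_ord0 big_geq // /t big_geq //= !mul0n !expr0; ring.
(* Telescoping certificate: the increments of [t] over [j <= k] add up to [- U k]. *)
pose U j := (-1) ^+ j * (\prod_(j <= i < n) (1 - x ^+ i.+1))
                  * x ^+ (j.+1 * n.+1 + 'C(j.+1, 2)).
have tel k : (k <= n)%N -> \sum_(j < k.+1) (t n.+1 j - t n j) = - U k.
  elim: k => [_|k IHk lekn].
    rewrite big_ord_recl big_ord0 /t /U big_nat_recr //= !mul0n mul1n bin_small //.
    rewrite !addn0 !expr0; ring.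
  rewrite big_ord_recr /= IHk; last exact: ltnW.
  rewrite /t /U (big_nat_recr n) //= [in X in - X + _](big_ltn lekn).
  have -> : (k.+1 * n.+1 + 'C(k.+1, 2) = k.+1 * n + 'C(k.+2, 2))%N.
    by rewrite (binS k.+1) bin1; lia.
  have -> : (k.+1 * n.+1 + 'C(k.+2, 2) = (k.+1 * n + 'C(k.+2, 2)) + k.+1)%N by lia.
  have -> : (k.+2 * n.+1 + 'C(k.+2, 2) = (k.+1 * n + 'C(k.+2, 2)) + k.+1 + n.+1)%N by lia.
  rewrite !exprD !exprS; ring.
have -> : \sum_(j < n.+2) t n.+1 j = \sum_(j < n.+1) t n j - U n + t n.+1 n.+1.
  rewrite big_ord_recr /=; congr (_ + _).
  by have /eqP := tel n (leqnn n); rewrite sumrB subr_eq => /eqP ->; rewrite addrC.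
rewrite IHn [in RHS]big_nat_recr //= -addrA [RHS]addrA; congr (_ + _).
rewrite /U /t !big_geq // /pent_neg /pent_pos exprS; ring.
Qed.

Lemma pent_neg_ge j : (j <= pent_neg j)%N.
Proof. by rewrite /pent_neg; nia. Qed.

Lemma pent_pos_neg j : pent_pos j = (pent_neg j + j)%N.
Proof. by rewrite /pent_pos /pent_neg binS bin1 addnA. Qed.

(** At [x = X], a term of Shanks' sum with [j >= 1] carries a power of [X] above [n], so the
    coefficient of [X^n] on the left comes from the product at [j = 0] alone. *)
Lemma euler_coefE n : euler_coef n =
  (n == 0%N)%:R + \sum_(1 <= j < n.+1)
     (-1) ^+ j * ((n == pent_neg j)%:R + (n == pent_pos j)%:R).
Proof.
have := congr1 (fun p : {poly int} => p`_n) (shanks_identity 'X n).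
rewrite big_ord_recl coefD coef_sum /= mul0n bin_small // addn0 !expr0 mul1r mulr1.
rewrite [X in _ + X = _]big1 ?addr0 => [|j _]; last first.
  rewrite coefMXn ifT //= /bump leq0n add1n (binS j.+1) bin1.
  by have := ltn_ord j; nia.
have -> : \prod_(0 <= i < n) (1 - 'X^(i.+1)) = \prod_(1 <= k < n.+1) (1 - 'X^k : {poly int}).
  by rewrite big_add1.
rewrite /euler_coef => ->; rewrite coefD coef1 coef_sum; congr (_ + _).
apply: eq_bigr => j _.
by rewrite -(rmorph_sign (@polyC int)) coefCM coefD !coefXn.
Qed.

Lemma pent_neg_mono : {mono pent_neg : i j / (i <= j)%N}.
Proof.
apply: leq_mono => i j; rewrite /pent_neg => lij.
have := leq_bin2l 2 (ltnW lij); nia.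
Qed.

(* the exponents [pent_neg j], [pent_pos j] lie below [pent_neg M.+1] exactly when [j <= M] *)
Lemma euler_sum (R : pzRingType) (phi : nat -> R) (M : nat) :
  \sum_(1 <= n < (pent_pos M).+1) (euler_coef n)%:~R * phi n =
  \sum_(1 <= j < M.+1) (-1) ^+ j * (phi (pent_neg j) + phi (pent_pos j)).
Proof.
set N := pent_pos M.
(* Terms with [j > n] vanish because [j <= pent_neg j], so one range of [j] serves all [n <= N] and
   the sums can be exchanged. *)
have extend n : (1 <= n < N.+1)%N -> euler_coef n =
    \sum_(1 <= j < N.+1) (-1) ^+ j * ((n == pent_neg j)%:R + (n == pent_pos j)%:R).
  move=> /andP[n0 nN]; rewrite euler_coefE (gtn_eqF n0) add0r.
  rewrite [RHS](@big_cat_nat _ _ _ n.+1) //= [X in _ = _ + X]big_nat [X in _ = _ + X]big1 ?addr0 // => j /andP[nj _].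
  have := pent_neg_ge j; have := pent_pos_neg j => e1 e2.
  have -> : (n == pent_neg j) = false by apply/eqP; lia.
  have -> : (n == pent_pos j) = false by apply/eqP; lia.
  by rewrite addr0 mulr0.
have pick g : (0 < g)%N -> \sum_(1 <= n < N.+1) (n == g)%:R * phi n = (g <= N)%N%:R * phi g.
  move=> g0; case: (leqP g N) => gN; last first.
    rewrite mul0r big_nat big1 // => n /andP[_ nN].
    by rewrite (ltn_eqF (leq_trans nN gN)) mul0r.
  rewrite (bigD1_seq g) ?iota_uniq ?mem_index_iota ?g0 //= eqxx big1 ?addr0 // => n /negbTE ->.
  by rewrite mul0r.
rewrite big_nat; under eq_bigr => n Hn.
  rewrite (extend n Hn) rmorph_sum /= mulr_suml; under eq_bigr do
    rewrite rmorphM rmorphXn rmorphN1 rmorphD /= !mulrz_nat -mulrA mulrDl; over.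
rewrite -big_nat exchange_big /=.
have {}pick j : (0 < j)%N -> \sum_(1 <= n < N.+1) (-1) ^+ j *
    ((n == pent_neg j)%:R * phi n + (n == pent_pos j)%:R * phi n) =
    (-1) ^+ j * ((pent_neg j <= N)%N%:R * phi (pent_neg j) + (pent_pos j <= N)%N%:R * phi (pent_pos j)).
  move=> j0; have := pent_neg_ge j; have := pent_pos_neg j => e1 e2.
  by rewrite -mulr_sumr big_split /= !pick //; lia.
rewrite big_nat; under eq_bigr => j /andP[j0 _] do rewrite pick //.
rewrite -big_nat (@big_cat_nat _ _ _ M.+1) //=; last first.
  by rewrite ltnS /N pent_pos_neg; have := pent_neg_ge M; lia.
rewrite [X in _ + X]big_nat [X in _ + X]big1 ?addr0 => [|j /andP[Mj _]].
  rewrite big_nat [RHS]big_nat; apply: eq_bigr => j /andP[_]; rewrite ltnS => jM.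
  have := pent_neg_mono j M; rewrite jM => le1.
  have -> : (pent_pos j <= N)%N by rewrite /N !pent_pos_neg leq_add.
  have -> : (pent_neg j <= N)%N by rewrite /N pent_pos_neg (leq_trans le1) ?leq_addr.
  by rewrite !mul1r.
have ltN : (N < pent_neg j)%N.
  apply: (@leq_trans (pent_neg M.+1)); last by rewrite pent_neg_mono.
  by rewrite /N /pent_pos /pent_neg; nia.
have -> : (pent_neg j <= N)%N = false by rewrite leqNgt ltN.
have -> : (pent_pos j <= N)%N = false by rewrite pent_pos_neg leqNgt ltn_addr.
by rewrite !mul0r addr0 mulr0.
Qed.

(** * Sums over symmetric ranges of integers *)

Definition int_ball (M : nat) : seq int := [seq i%:Z - M%:Z | i <- iota 0 M.*2.+1].

Lemma mem_int_ball M (k : int) : (k \in int_ball M) = (`|k| <= M)%N.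
Proof.
apply/mapP/idP => [[i]|kM]; first by rewrite mem_iota => ? ->; lia.
by exists `|(k + M%:Z)%R|%N; rewrite ?mem_iota; lia.
Qed.

Lemma uniq_int_ball M : uniq (int_ball M).
Proof. by rewrite map_inj_uniq ?iota_uniq // => i j; lia. Qed.

Lemma big_int_ball (V : nmodType) (M : nat) (f : int -> V) :
  \sum_(k <- int_ball M) f k = f 0 + \sum_(1 <= j < M.+1) (f j%:Z + f (- j%:Z)).
Proof.
elim: M => [|M IHM]; first by rewrite /int_ball big_map big_seq1 subrr big_geq // addr0.
rewrite (perm_big (M.+1%:Z :: - M.+1%:Z :: int_ball M)) /=; last first.
  apply: uniq_perm; first exact: uniq_int_ball.
    rewrite cons_uniq in_cons mem_int_ball cons_uniq mem_int_ball uniq_int_ball.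
    by apply/andP; split; lia.
  by move=> k; rewrite mem_int_ball 2!in_cons mem_int_ball; lia.
by rewrite 2!big_cons IHM [in RHS]big_nat_recr //= [RHS]addrA [RHS]addrC -!addrA.
Qed.

Lemma big_uniq_eq_mem (V : nmodType) (T : eqType) (s t : seq T) (f : T -> V) :
  uniq s -> uniq t -> s =i t -> \sum_(k <- s) f k = \sum_(k <- t) f k.
Proof. by move=> us ut st; apply: perm_big; apply: uniq_perm. Qed.

Lemma ler_sum_sub (R : numDomainType) (T : eqType) (s t : seq T) (f : T -> R) :
  uniq s -> {subset s <= t} -> (forall k, 0 <= f k) ->
  \sum_(k <- s) f k <= \sum_(k <- t) f k.
Proof.
elim: s t => [|a s IHs] t /=; first by move=> _ _ f0; rewrite big_nil sumr_ge0.
move=> /andP[nas us] st f0; rewrite big_cons (big_rem a (st _ (mem_head _ _))) /= lerD2l.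
apply: IHs => // k ks; have kt : k \in t by rewrite st ?inE ?ks ?orbT.
have := perm_to_rem (st a (mem_head _ _)) => /perm_mem/(_ k); rewrite kt inE => /esym/orP[/eqP kk|//].
by rewrite -kk ks in nas.
Qed.

(** * Trigonometric sums and the roots-of-unity filter *)

Section Trigonometry.
Variable R : realType.
Implicit Types (x phi psi theta v : R) (k : int).

Lemma cosD2pik x k : cos (x + 2 * pi * k%:~R) = cos x.
Proof.
have step (n : nat) (y : R) : cos (y + 2 * pi * n%:R) = cos y.
  by rewrite -(periodicn (@cosD2pi R) n y); congr cos; ring.
case: k => n; first exact: step.
by rewrite NegzE mulrNz -[LHS](step n.+1); congr cos; rewrite pmulrn; ring.
Qed.

Lemma cosDpik x k : cos (x + pi * k%:~R) = (-1) ^+ `|k| * cos x.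
Proof.
have step (n : nat) (y : R) : cos (y + pi * n%:R) = (-1) ^+ n * cos y.
  elim: n => [|n IHn] in y *; first by rewrite mulr0 addr0 expr0 mul1r.
  by rewrite -natr1 mulrDr mulr1 addrA cosDpi IHn exprS; ring.
case: k => n; first exact: step.
rewrite NegzE mulrNz abszN absz_nat -[RHS]mul1r -(sqrr_sign _ n.+1) expr2 -mulrA.
have -> : cos x = (-1) ^+ n.+1 * cos (x + pi * - n.+1%:~R).
  by rewrite -step; congr cos; rewrite pmulrn; ring.
by rewrite [in RHS]mulrA -!expr2 !sqrr_sign !mul1r mulrA -expr2 sqrr_sign mul1r.
Qed.

Lemma mul2cos_sin x v : cos x * (2 * sin v) = sin (x + v) - sin (x - v).
Proof. by rewrite sinD sinB; ring. Qed.

Lemma mul2cos_cos x v : cos x * (2 * cos v) = cos (x + v) + cos (x - v).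
Proof. by rewrite cosD cosB; ring. Qed.

(** The factor [2 sin (theta / 2)] makes the sum telescope. This serves the roots-of-unity filter
    and, later, the partial sums of signs along a line. *)
Lemma sum_cos_arith phi theta (n : nat) :
  (\sum_(j < n) cos (phi + j%:R * theta)) * (2 * sin (theta / 2)) =
  sin (phi + (n%:R - 1 / 2) * theta) - sin (phi - theta / 2).
Proof.
elim: n => [|n IHn].
  by rewrite big_ord0 mul0r; apply/esym/eqP; rewrite subr_eq0; apply/eqP; congr sin; field.
rewrite big_ord_recr /= mulrDl IHn mul2cos_sin -[n.+1%:R]natr1.
rewrite (_ : phi + _ * theta + theta / 2 = phi + (n%:R + 1 - 1 / 2) * theta); last by field.
rewrite (_ : phi + n%:R * theta - theta / 2 = phi + (n%:R - 1 / 2) * theta); last by field.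
by ring.
Qed.

Lemma root_of_unity_filter phi (L : nat) (d : int) : (0 < L)%N ->
  \sum_(j < L) cos (phi + j%:R * (2 * pi * d%:~R / L%:R)) =
  if (L %| d)%Z then L%:R * cos phi else 0.
Proof.
move=> L0; have LR0 : (L%:R : R) != 0 by rewrite pnatr_eq0 -lt0n.
(* Only [d] modulo [L] matters: the quotient shifts the angle by a multiple of [2 pi]. *)
have red (j : nat) : cos (phi + j%:R * (2 * pi * d%:~R / L%:R)) =
    cos (phi + j%:R * (2 * pi * (d %% L)%Z%:~R / L%:R)).
  rewrite -[RHS](cosD2pik _ (j%:Z * (d %/ L)%Z)) [in LHS](divz_eq d L); congr cos.
  by rewrite !(rmorphD, rmorphM) /= -!pmulrn; field.
under eq_bigr do rewrite red.
have [r er] : exists r : nat, (d %% L)%Z = r.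
  by exists `|(d %% L)%Z|%N; rewrite gez0_abs // modz_ge0 //; lia.
have rL : (r < L)%N by have := @ltz_pmod d L; lia.
have -> : (L %| d)%Z = (r == 0%N) by apply/dvdz_mod0P/eqP; rewrite er; lia.
rewrite er; have [->|r0] := eqVneq r 0%N.
  under eq_bigr do rewrite mulr0 mul0r mulr0 addr0.
  by rewrite sumr_const card_ord mulr_natl.
set th := 2 * pi * r%:~R / L%:R.
have s0 : 0 < sin (th / 2).
  have rR : 0 < (r%:R : R) by rewrite ltr0n lt0n.
  have rl : r%:R < (L%:R : R) by rewrite ltr_nat.
  have Lp : 0 < (L%:R : R) by rewrite ltr0n.
  have -> : th / 2 = pi * (r%:R / L%:R) by rewrite /th -pmulrn; field.
  apply: sin_gt0_pi; rewrite mulr_gt0 ?pi_gt0 ?divr_gt0 //=.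
  by rewrite gtr_pMr ?pi_gt0 // ltr_pdivrMr // mul1r.
apply/eqP; have /eqP := sum_cos_arith phi th L.
rewrite (_ : phi + _ * th = phi - th / 2 + 2 * pi * r%:~R); last by rewrite /th; field.
have -> : sin (phi - th / 2 + 2 * pi * r%:~R) = sin (phi - th / 2).
  by rewrite -!cosBpihalf -[RHS](cosD2pik _ r); congr cos; ring.
by rewrite subrr mulf_eq0 mulf_eq0 pnatr_eq0 /= (gt_eqF s0) orbF.
Qed.

Lemma cos_mul_2cosX psi v (n : nat) :
  cos psi * (2 * cos v) ^+ n =
  \sum_(i < n.+1) 'C(n, i)%:R * cos (psi + (n%:R - 2 * i%:R) * v).
Proof.
elim: n psi => [|n IHn] psi.
  by rewrite big_ord_recl big_ord0 bin0 expr0 mulr1 mul1r addr0 mulr0 subrr mul0r addr0.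
rewrite exprS mulrA mul2cos_cos mulrDl !IHn.
rewrite [RHS]big_ord_recl /= bin0 mul1r.
under [in RHS]eq_bigr => i _ do rewrite /bump leq0n add1n binS natrD mulrDl.
rewrite big_split /= [X in _ = _ + (X + _)]big_ord_recr /= bin_small // mul0r addr0 addrA.
congr (_ + _); last first.
  apply: eq_bigr => i _; congr (_ * cos _); rewrite -[n.+1%:R]natr1 -?[i.+1%:R]natr1; ring.
rewrite [LHS]big_ord_recl /= bin0 mul1r; congr (_ + _).
  by congr cos; rewrite -[n.+1%:R]natr1; ring.
apply: eq_bigr => i _; rewrite /bump leq0n add1n; congr (_ * cos _); rewrite -[n.+1%:R]natr1 -?[i.+1%:R]natr1; ring.
Qed.

(** Row [2 m] of Pascal's triangle centred at its middle: up to scale a discrete form of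
    [exp (- i^2 / m)], zero for [|i| > m]. *)
Definition cbin (m : nat) (i : int) : nat := 'C(m.*2, m + `|i|).

Lemma cos_mul_2cosXdouble psi v (m : nat) :
  cos psi * (2 * cos v) ^+ m.*2 =
  \sum_(i <- int_ball m) (cbin m i)%:R * cos (psi + 2 * i%:~R * v).
Proof.
rewrite cos_mul_2cosX -(big_mkord xpredT (fun i => 'C(m.*2, i)%:R * cos (psi + (m.*2%:R - 2 * i%:R) * v))).
rewrite (@big_uniq_eq_mem _ _ (int_ball m) [seq m%:Z - i%:Z | i <- index_iota 0 m.*2.+1]); first last.
- move=> k; rewrite mem_int_ball; apply/idP/mapP => [km|[i]].
    by exists `|(m%:Z - k)%R|%N; rewrite ?mem_index_iota; lia.
  by rewrite mem_index_iota; lia.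
- by rewrite map_inj_uniq ?iota_uniq // => i j; lia.
- exact: uniq_int_ball.
rewrite big_map big_seq [RHS]big_seq; apply: eq_bigr => i; rewrite mem_index_iota => /andP[_ im].
congr (_%:R * cos (_ + _ * _)); last first.
  by rewrite rmorphB /= -!pmulrn -mul2n natrM; ring.
rewrite /cbin; have [le|lt] := leqP i m.
  rewrite (_ : `|_|%N = m - i)%N; last by lia.
  by rewrite -bin_sub; [congr 'C(_, _)|]; lia.
by congr 'C(_, _); lia.
Qed.

End Trigonometry.

(** * Gaussian estimates for binomial coefficients *)

Section Binomial.
Variable R : realType.

(** Central binomials have ratio [2 (2 m + 1) / (m + 1)], and [(2 m + 1)^2 >= 4 m (m + 1)]. This
    controls the factor [4^m / cbin m 0], of order [sqrt m], on the dual side. *)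
Lemma central_bin_lower (m : nat) : (0 < m)%N ->
  (16 ^ m <= 4 * m * 'C(m.*2, m) ^ 2)%N.
Proof.
case: m => // m _; elim: m => [//|m IHm].
have rec : (m.+2 * 'C(m.+2.*2, m.+2) = 2 * (2 * m.+1 + 1) * 'C(m.+1.*2, m.+1))%N.
  have e1 : 'C(m.+2.*2, m.+2) = (2 * 'C(m.+1.*2.+1, m.+2))%N.
    have -> : m.+2.*2 = m.+1.*2.+2 by lia.
    rewrite binS [X in (_ + X)%N](_ : _ = 'C(m.+1.*2.+1, m.+2)); first by lia.
    by rewrite -bin_sub; [congr 'C(_, _)|]; lia.
  have := mul_bin_diag m.+1.*2.+1 m.+1; rewrite e1 /=; nia.
move: IHm rec; set a := 'C(_, m.+1); set b := 'C(_, m.+2) => IHm rec.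
rewrite -(leq_pmul2l (_ : 0 < m.+2)%N) // expnS.
have : (m.+2 * (4 * m.+2 * b ^ 2) = 4 * (m.+2 * b) ^ 2)%N by ring.
rewrite rec => ->.
have : (16 * m.+2 * 16 ^ m.+1 <= 16 * m.+2 * (4 * m.+1 * a ^ 2))%N by rewrite leq_pmul2l.
move=> h; nia.
Qed.

Lemma cbinS (m a : nat) : (a < m)%N ->
  ((cbin m a.+1)%:R : R) = (cbin m a)%:R * ((m%:R - a%:R) / (m%:R + a%:R + 1)).
Proof.
move=> am; rewrite mulrA -[LHS](@mulfK _ (m%:R + a%:R + 1)); last first.
  by rewrite -!natrD natr1 pnatr_eq0.
congr (_ / _); rewrite -natrB 1?ltnW // -!natrD natr1 -!natrM; congr _%:R.
have := mul_bin_left m.*2 (m + a); rewrite /cbin /=.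
by rewrite (_ : m.*2 - (m + a) = m - a)%N ?addnS; lia.
Qed.

(** The successive ratio [1 - (2 a + 1) / (m + a + 1)] is at most [exp (- (2 a + 1) / (m + a + 1))],
    and the odd numbers add up to [a^2]. *)
Lemma cbin_upper (m a : nat) : (a <= m)%N ->
  ((cbin m a)%:R : R) <= (cbin m 0)%:R * expR (- (a%:R ^+ 2 / (m%:R + a%:R))).
Proof.
elim: a => [_|a IHa am]; first by rewrite expr0n mul0r oppr0 expR0 mulr1.
have mp : 0 < (m%:R : R) by rewrite ltr0n; lia.
have ap : 0 <= (a%:R : R) by [].
rewrite cbinS //; apply: le_trans (_ : _ <= (cbin m 0)%:R *
   expR (- (a%:R ^+ 2 / (m%:R + a%:R))) * expR (- ((2 * a%:R + 1) / (m%:R + a%:R + 1)))) _.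
  apply: ler_pM => //; first by rewrite divr_ge0 ?subr_ge0 ?ler_nat 1?ltnW // -!natrD.
    exact/IHa/ltnW.
  apply: le_trans (expR_ge1Dx _); rewrite lerBrDr -mulrDl ler_pdivrMr; last by lra.
  by rewrite mul1r; lra.
rewrite -mulrA -expRD ler_wpM2l // ler_expR -opprD lerN2 -[a.+1%:R]natr1.
apply: le_trans (_ : _ <= (a%:R ^+ 2 + (2 * a%:R + 1)) / (m%:R + a%:R + 1)) _.
  by rewrite addrA (_ : (_ + 1) ^+ 2 = a%:R ^+ 2 + (2 * a%:R + 1)) //; ring.
rewrite mulrDl lerD2r ler_wpM2l ?sqr_ge0 // lef_pV2 ?posrE; lra.
Qed.

(** Same induction with the inverse ratio [1 + (2 a + 1) / (m - a)]. *)
Lemma cbin_lower (m a : nat) : (a <= m)%N ->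
  ((cbin m 0)%:R : R) * expR (- (a%:R ^+ 2 / (m%:R - a%:R + 1))) <= (cbin m a)%:R.
Proof.
elim: a => [_|a IHa am]; first by rewrite expr0n mul0r oppr0 expR0 mulr1.
have mp : (a%:R : R) + 1 <= m%:R by rewrite natr1 ler_nat.
have ap : 0 <= (a%:R : R) by [].
rewrite cbinS //; apply: le_trans (_ : (cbin m 0)%:R *
   expR (- (a%:R ^+ 2 / (m%:R - a%:R + 1))) * expR (- ((2 * a%:R + 1) / (m%:R - a%:R))) <= _); last first.
  apply: ler_pM => //; rewrite ?mulr_ge0 ?expR_ge0 //; first exact/IHa/ltnW.
  rewrite expRN -[leRHS]invrK lef_pV2 ?posrE ?invr_gt0 ?divr_gt0 ?expR_gt0 //; try lra.
  apply: le_trans (expR_ge1Dx _); rewrite invf_div.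
  have ne : (m%:R : R) - a%:R != 0 by rewrite gt_eqF //; lra.
  rewrite (_ : m%:R + a%:R + 1 = (m%:R - a%:R) + (2 * a%:R + 1)); last by ring.
  by rewrite mulrDl divff.
rewrite -mulrA -expRD ler_wpM2l // ler_expR -opprD lerN2 -[a.+1%:R]natr1.
apply: le_trans (_ : (a%:R ^+ 2 + (2 * a%:R + 1)) / (m%:R - a%:R) <= _).
  rewrite [leRHS]mulrDl lerD2r ler_wpM2l ?sqr_ge0 // lef_pV2 ?posrE; lra.
rewrite (_ : m%:R - (a%:R + 1) + 1 = m%:R - a%:R); last by ring.
by rewrite (_ : (_ + 1) ^+ 2 = a%:R ^+ 2 + (2 * a%:R + 1)) //; ring.
Qed.

(** Coarser than [cbin_upper], but valid for every [i] with a fixed denominator; it serves the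
    uniform tail estimate. *)
Lemma cbin_gauss (m : nat) (i : int) : (0 < m)%N ->
  ((cbin m i)%:R : R) <= (cbin m 0)%:R * expR (- (i%:~R ^+ 2 / (2 * m%:R))).
Proof.
move=> m0; have [im|mi] := leqP `|i| m; last first.
  by rewrite {1}/cbin bin_small ?mulr_ge0 ?expR_ge0 //; lia.
have -> : cbin m i = cbin m `|i|%N by [].
apply: le_trans (cbin_upper im) _; rewrite ler_wpM2l // ler_expR lerN2.
have -> : (i%:~R : R) ^+ 2 = `|i|%N%:R ^+ 2.
  by rewrite natr_absz intr_norm real_normK ?num_real.
rewrite ler_wpM2l ?sqr_ge0 // lef_pV2 ?posrE ?mulr_gt0 ?ltr0n // -?natrM -?natrD ?ltr0n ?ler_nat; lia.
Qed.

End Binomial.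

(** * Gaussian sums over primitive lattice points *)

Section LatticeSum.
Variable R : realType.
Implicit Types (t X Y : R).

Lemma sum_invsqr_int (A : seq int) : uniq A ->
  \sum_(j <- A) (1 + j%:~R ^+ 2 : R)^-1 <= 5.
Proof.
move=> uA; pose K := \max_(j <- A) `|j|%N.
have pos (j : int) : 0 <= (1 + j%:~R ^+ 2 : R)^-1 by rewrite invr_ge0 addr_ge0 ?sqr_ge0.
apply: le_trans (_ : _ <= \sum_(j <- int_ball K) (1 + j%:~R ^+ 2 : R)^-1) _.
  apply: ler_sum_sub => // j jA; rewrite mem_int_ball /K.
  by rewrite (big_rem j jA) /= leq_maxl.
rewrite big_int_ball expr0n addr0 invr1.
rewrite (_ : 5 = 1 + 4); last by ring.
rewrite lerD2l.
(* Telescoping majorant: [2 / (1 + j^2) <= 4 / j - 4 / (j + 1)]. *)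
apply: le_trans (_ : _ <= 4 - 4 / K.+1%:R) _; last by rewrite gerBl divr_ge0.
elim: K => [|K IHK]; first by rewrite big_geq // divr1 subrr.
rewrite big_nat_recr //=.
apply: le_trans (_ : _ <= (4 - 4 / K.+1%:R) + (4 / K.+1%:R - 4 / K.+2%:R)) _; last by rewrite addrA subrK.
apply: lerD => //; rewrite mulrNz sqrrN -pmulrn -[K.+2%:R]natr1 -[K.+1%:R]natr1.
set x := K%:R; have x0 : 0 <= (x : R) by [].
rewrite -mulr2n -[_^-1 *+ 2]mulr_natl.
have -> : 4 / (x + 1) - 4 / (x + 1 + 1) = 4 / ((x + 1) * (x + 1 + 1)) :> R.
  by field; apply/andP; split; rewrite gt_eqF //; lra.
rewrite ler_pdivrMr; last by rewrite addrC ltr_wpDl ?sqr_ge0.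
by rewrite mulrAC ler_pdivlMr; [nra|apply: mulr_gt0; lra].
Qed.

(** Replacing [t] by its floor costs a factor 3, hence [15 = 3 * 5]. *)
Lemma sum_invsqr_shift t (A : seq int) : uniq A ->
  \sum_(l <- A) (1 + (t + l%:~R) ^+ 2)^-1 <= 15.
Proof.
move=> uA; pose f := Num.floor t.
apply: le_trans (_ : _ <= \sum_(j <- [seq f + l | l <- A]) 3 * (1 + j%:~R ^+ 2)^-1) _; last first.
  rewrite -mulr_sumr (_ : 15 = 3 * 5); last by ring.
  by apply: ler_wpM2l => //; apply: sum_invsqr_int; rewrite map_inj_uniq // => i j /addrI.
rewrite big_map; apply: ler_sum => l _; rewrite rmorphD /=.
have := floor_le t; have := floorD1_gt t; rewrite -/f rmorphD /= => h1 h2.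
set a := f%:~R in h1 h2 *; set b := l%:~R.
have p1 : 0 < 1 + (a + b) ^+ 2 by rewrite ltr_pwDl ?sqr_ge0.
have p2 : 0 < 1 + (t + b) ^+ 2 by rewrite ltr_pwDl ?sqr_ge0.
rewrite -(ler_pM2l p1) mulrCA divff ?gt_eqF // mulr1 ler_pdivrMr //.
have [tau et] : exists tau, t = a + tau by exists (t - a); ring.
rewrite et rmorph1 in h1 h2 *; have : 0 <= (a + b + 2 * tau) ^+ 2 by exact: sqr_ge0.
have : tau ^+ 2 <= 1 by rewrite expr_le1 //; lra.
nra.
Qed.

(** With [Z = X + i Y] this is [exp (- |h Z + l|^2 / (4 Y))], a form on which the modular group
    acts. *)
Definition lattice_gauss X Y (v : int * int) : R :=
  expR (- (Y * v.1%:~R ^+ 2 + (v.1%:~R * X + v.2%:~R) ^+ 2 / Y) / 4).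

(** For [h = 0] coprimality leaves only [l = 1] or [l = -1]. For [h^2 >= 1] the factor [Y] lost in
    the decay in [h X + l] is regained from the decay of [exp (- Y h^2 / 4)], so the constant does
    not depend on [Y]. *)
Lemma lattice_gauss_decay X Y (v : int * int) : 1 / 2 <= Y -> coprimez v.1 v.2 ->
  lattice_gauss X Y v <=
  32 * ((1 + v.1%:~R ^+ 2)^-1 * (1 + (v.1%:~R * X + v.2%:~R) ^+ 2)^-1).
Proof.
case: v => h l /= Y2 hl; rewrite /lattice_gauss /=.
have Y0 : 0 < Y by lra.
set t := h%:~R * X + l%:~R.
have e x : 0 <= x -> expR (- x) <= (1 + x)^-1.
  by move=> x0; rewrite expRN lef_pV2 ?posrE ?expR_gt0 ?expR_ge1Dx //; lra.
have p1 : 0 < 1 + (h%:~R : R) ^+ 2 by rewrite ltr_pwDl ?sqr_ge0.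
have p2 : 0 < 1 + t ^+ 2 by rewrite ltr_pwDl ?sqr_ge0.
have tY : 0 <= t ^+ 2 / Y by rewrite divr_ge0 ?sqr_ge0 // ltW.
have hY : 0 <= Y * (h%:~R : R) ^+ 2 by rewrite mulr_ge0 ?sqr_ge0 // ltW.
rewrite -invfM ler_pdivlMr; last exact: mulr_gt0.
have [h0|h0] := eqVneq h 0.
  have l1 : (l%:~R : R) ^+ 2 = 1.
    have : (`|l| == 1)%N by move: hl; rewrite h0 /coprimez gcd0z; lia.
    by move=> l1; rewrite -rmorphXn /= (_ : l ^+ 2 = 1) //; nia.
  rewrite /t h0 mul0r add0r l1 expr0n /= addr0 !mul1r mulr0 add0r.
  apply: le_trans (_ : 1 + 1 <= _); last by lra.
  by rewrite ler_piMl ?addr_ge0 // -expR0 ler_expR mulNr oppr_le0 divr_ge0 // invr_ge0 ltW.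
have h1 : 1 <= (h%:~R : R) ^+ 2.
  by rewrite -rmorphXn /= -[1]/(1%:~R) ler_int; nia.
rewrite (_ : - _ / 4 = - (Y * h%:~R ^+ 2 / 4) - (t ^+ 2 / Y / 4)); last by field; rewrite gt_eqF.
rewrite expRD.
apply: le_trans (_ : _ <= ((1 + Y * h%:~R ^+ 2 / 4)^-1 * (1 + t ^+ 2 / Y / 4)^-1) *
                         ((1 + h%:~R ^+ 2) * (1 + t ^+ 2))) _.
  apply: ler_wpM2r; first by rewrite mulr_ge0 // ltW.
  by apply: ler_pM; rewrite ?expR_ge0 //; apply: e; exact: divr_ge0.
rewrite -invfM mulrC ler_pdivrMr; last by apply: mulr_gt0; lra.
set a := (h%:~R : R) ^+ 2 in h1 p1 hY *.
have -> : 32 * ((1 + Y * a / 4) * (1 + t ^+ 2 / Y / 4)) =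
          (8 * (1 + Y * a / 4) / Y) * (4 * (Y + t ^+ 2 / 4)).
  by field; rewrite gt_eqF.
apply: ler_pM; rewrite ?(ltW p1) ?(ltW p2) //; last by lra.
rewrite ler_pdivlMr //; nra.
Qed.

(* Translations [X -> X - r] and the inversion [Z -> - 1 / Z] of [Z = X + i Y] permute the
   coprime pairs, and the latter at least doubles [Y] when [|X| <= 1/2] and [Y < 1/2]. *)
Lemma lattice_gauss_sum X Y (A : seq (int * int)) : 0 < Y -> uniq A ->
  {in A, forall v, coprimez v.1 v.2} ->
  \sum_(v <- A) lattice_gauss X Y v <= 50 ^+ 2.
Proof.
have base X0 Y0 (B : seq (int * int)) : 1 / 2 <= Y0 -> uniq B ->
    {in B, forall v, coprimez v.1 v.2} -> \sum_(v <- B) lattice_gauss X0 Y0 v <= 50 ^+ 2.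
  move=> Y2 uB cB; pose f (v : int * int) : R :=
    32 * ((1 + v.1%:~R ^+ 2)^-1 * (1 + (v.1%:~R * X0 + v.2%:~R) ^+ 2)^-1).
  pose K := (\max_(v <- B) maxn `|v.1| `|v.2|)%N.
  apply: le_trans (_ : _ <= \sum_(v <- B) f v) _.
    by rewrite big_seq [leRHS]big_seq; apply: ler_sum => v vB; apply: lattice_gauss_decay => //; exact: cB.
  have fge0 v : 0 <= f v.
    by rewrite !mulr_ge0 // invr_ge0 addr_ge0 ?sqr_ge0.
  apply: le_trans (_ : _ <= \sum_(v <- [seq (h, l) | h <- int_ball K, l <- int_ball K]) f v) _.
    apply: ler_sum_sub => // -[h l] vB; apply/allpairsP; exists (h, l).
    have : (maxn `|h| `|l| <= K)%N by rewrite /K (big_rem _ vB) /= leq_maxl.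
    by rewrite geq_max !mem_int_ball => /andP[-> ->].
  rewrite big_allpairs /f /=.
  apply: le_trans (_ : _ <= \sum_(h <- int_ball K) (32 * 15) * (1 + h%:~R ^+ 2)^-1) _.
    apply: ler_sum => h _; rewrite -mulr_sumr -mulr_sumr.
    rewrite -mulrA; apply: ler_wpM2l; first exact: ler0n.
    rewrite mulrC; apply: ler_wpM2r; first by rewrite invr_ge0 addr_ge0 ?sqr_ge0.
    exact/sum_invsqr_shift/uniq_int_ball.
  rewrite -mulr_sumr; apply: le_trans (_ : _ <= 32 * 15 * 5) _; last by lra.
  by apply: ler_wpM2l; [exact: mulr_ge0|exact/sum_invsqr_int/uniq_int_ball].
have tr X0 Y0 (r : int) (B : seq (int * int)) :
    \sum_(v <- B) lattice_gauss X0 Y0 v =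
    \sum_(v <- [seq (v.1, v.2 + r * v.1) | v <- B]) lattice_gauss (X0 - r%:~R) Y0 v.
  rewrite big_map; apply: eq_bigr => -[h l] _; rewrite /lattice_gauss /=.
  rewrite (_ : h%:~R * (X0 - _) + _ = h%:~R * X0 + l%:~R) //.
  by rewrite rmorphD rmorphM /=; ring.
have inv X0 Y0 (B : seq (int * int)) : 0 < Y0 ->
    \sum_(v <- B) lattice_gauss X0 Y0 v =
    \sum_(v <- [seq (v.2, - v.1) | v <- B])
      lattice_gauss (- X0 / (X0 ^+ 2 + Y0 ^+ 2)) (Y0 / (X0 ^+ 2 + Y0 ^+ 2)) v.
  move=> Y0gt0; rewrite big_map; apply: eq_bigr => -[h l] _; rewrite /lattice_gauss /=.
  rewrite [X in - X / 4](_ : _ = Y0 / (X0 ^+ 2 + Y0 ^+ 2) * l%:~R ^+ 2 +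
    (l%:~R * (- X0 / (X0 ^+ 2 + Y0 ^+ 2)) + (- h)%:~R) ^+ 2 / (Y0 / (X0 ^+ 2 + Y0 ^+ 2))) //.
  rewrite mulrNz; field.
  by rewrite !gt_eqF // ltr_wpDl ?sqr_ge0 // exprn_gt0.
move=> Y0 uA cA.
(* The number of doublings that lift [Y] to [1 / 2] is the induction variable of the reduction to a
   fundamental domain. *)
have [n Yn] : exists n : nat, 1 / 2 <= Y * 2 ^+ n.
  exists (Num.truncn Y^-1).+1.
  have := truncnS_gt (Y^-1); set n := (Num.truncn _).+1 => lt.
  have h : (n%:R : R) <= 2 ^+ n by rewrite -natrX ler_nat ltnW // ltn_expl.
  have : 1 <= Y * n%:R by rewrite -ler_pdivrMl // mulr1 ltW.
  nra.
elim: n => [|n IHn] in X Y A Y0 uA cA Yn *; first by apply: base => //; rewrite expr0 mulr1 in Yn.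
have [Y2|Y2] := leP (1 / 2) Y; first exact: base.
(* Subtracting the nearest integer gives [|X1| <= 1 / 2], so [D = |Z|^2 <= 1 / 2] and the inversion
   sends [Y] to [Y / D >= 2 Y]. *)
pose r := Num.floor (X + 1 / 2); pose X1 := X - r%:~R.
have X1h : X1 ^+ 2 <= 1 / 4.
  have := floor_le (X + 1 / 2); have := floorD1_gt (X + 1 / 2).
  by rewrite -/r rmorphD /= /X1; nra.
pose D := X1 ^+ 2 + Y ^+ 2.
have D0 : 0 < D by rewrite /D ltr_wpDl ?sqr_ge0 // exprn_gt0.
have D2 : D <= 1 / 2 by rewrite /D; nra.
rewrite (tr _ _ r) (inv _ _ _ Y0) -/X1 -/D; apply: IHn.
- exact: divr_gt0.
- rewrite map_inj_uniq; last by move=> [a b] [c d] /= [-> /oppr_inj->].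
  rewrite map_inj_uniq //; move=> [a b] [c d] /= [-> /eqP]; rewrite (inj_eq (addIr _)).
  by move/eqP->.
- move=> _ /mapP[_ /mapP[v vA ->] ->] /=.
  by rewrite coprimezN coprimez_sym /coprimez addrC gcdzMDl; exact: cA.
- rewrite mulrAC ler_pdivlMr //; move: Yn; rewrite exprS => Yn.
  apply: le_trans (_ : 1 / 2 * (1 / 2) <= _); first by rewrite ler_wpM2l.
  by nra.
Qed.

End LatticeSum.

(** * Sums along lines through the origin *)

Section OrbitSums.
Variable R : realType.
Implicit Types (x y t u : R).

Lemma ndecr_is_derive (f f' : R -> R) (a b : R) : a <= b ->
  (forall x, a <= x <= b -> is_derive x 1 f (f' x)) ->
  (forall x, a <= x <= b -> 0 <= f' x) -> f a <= f b.
Proof.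
move=> ab df f0; apply: (@ger0_derive1_ndecr R f a b) => //.
- move=> x; rewrite in_itv /= => /andP[ax xb].
  by have dx : is_derive x 1 f (f' x) by [apply: df; rewrite !ltW]; exact: ex_derive.
- move=> x; rewrite in_itv /= => /andP[ax xb].
  have dx : is_derive x 1 f (f' x) by apply: df; rewrite !ltW.
  by rewrite derive1E derive_val f0 // !ltW.
- apply: continuous_in_subspaceT => x; rewrite inE /= in_itv /= => xab.
  have dx := df x xab.
  by apply: differentiable_continuous; apply/derivable1_diffP; exact: ex_derive.
Qed.

(** From [v cos v <= sin v] follows [cos^2 v <= 1 / (1 + v^2)], which is at most [1 - v^2 / 5]
    because [v^2 <= 4]. *)
Lemma cos_sqr_gauss u : `|u| <= pi / 2 -> cos u ^+ 2 <= expR (- (u ^+ 2 / 5)).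
Proof.
move=> uh; have pi4 : pi / 2 < 2 :> R := @pihalf_lt2 R.
rewrite -cos_norm -(real_normK (num_real u)).
set v := `|u| in uh *; have v0 : 0 <= v by exact: normr_ge0.
have c0 : 0 <= cos v by apply: cos_ge0_pihalf; rewrite uh andbT; lra.
have vs : v * cos v <= sin v.
  have := @ndecr_is_derive (fun z => sin z - z * cos z) (fun z => z * sin z) 0 v v0.
  rewrite sin0 mul0r subrr subr_ge0; apply => z /andP[z0 zv].
    by apply: is_derive_eq; rewrite /GRing.scale /=; ring.
  by rewrite mulr_ge0 // sin_ge0_pi // z0 /=; lra.
have key : cos v ^+ 2 * (1 + v ^+ 2) <= 1.
  rewrite -[leRHS](cos2Dsin2 v) mulrDr mulr1 lerD2l -exprMn mulrC lerXn2r ?nnegrE //.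
    exact: mulr_ge0.
  by apply: le_trans vs; exact: mulr_ge0.
apply: le_trans (expR_ge1Dx _).
have v2 : v ^+ 2 <= 4 by nra.
have := sqr_ge0 v; have := sqr_ge0 (cos v); nra.
Qed.

(** The cosine [y] of the full angle satisfies [4 y^3 - 3 y = -1], that is
    [(y + 1) (2 y - 1)^2 = 0], so [y <= 1 / 2] and the half angle has
    [sin^2 = (1 - y) / 2 >= 1 / 4]. *)
Lemma odd_angle_sin (k : int) : 1 / 2 <= `|sin (pi * (2 * k + 1)%:~R / 3 / 2) : R|.
Proof.
set b := pi * _ / 3 / 2; pose y := cos (b *+ 2).
have y3 : 4 * y ^+ 3 - 3 * y = -1.
  have : cos (b *+ 2 *+ 3) = -1.
    rewrite (_ : b *+ 2 *+ 3 = pi + 2 * pi * k%:~R).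
      by rewrite cosD2pik cospi.
    by rewrite /b rmorphD rmorphM /=; field.
  rewrite [in cos _]mulrSr cosD cos_mulr2n sin_mulr2n -/y => <-.
  rewrite (_ : (y * _) *+ 2 * _ = 2 * y * sin (b *+ 2) ^+ 2); last by ring.
  by rewrite sin2cos2 -/y; ring.
have y2 : y <= 1 / 2.
  have e0 : (y + 1) * (2 * y - 1) ^+ 2 = 0.
    have -> : (y + 1) * (2 * y - 1) ^+ 2 = (4 * y ^+ 3 - 3 * y) + 1 by ring.
    by rewrite y3 addNr.
  move/eqP: e0; rewrite mulf_eq0 sqrf_eq0 => /orP[] /eqP; lra.
have : y = 1 - 2 * sin b ^+ 2 by rewrite /y cos_mulr2n cos2sin2; ring.
move=> yE; rewrite -(@ler_sqr _ _ _) ?nnegrE // real_normK ?num_real //; lra.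
Qed.

Lemma abel_bound (c w : nat -> R) (B : R) (n : nat) :
  (forall k, `|\sum_(j < k) c j| <= B) ->
  (forall j, 0 <= w j.+1 <= w j) ->
  `|\sum_(j < n) c j * w j| <= B * w 0%N.
Proof.
move=> cB wd; have w0 j : 0 <= w j.
  by case: j => [|j]; have /andP[] := wd 0%N; [exact: le_trans|]; have /andP[] := wd j.
have B0 : 0 <= B by apply: le_trans (cB 0%N).
(* Summation by parts, with the boundary term subtracted so that the bound passes through the
   induction. *)
have : `|\sum_(j < n) c j * w j - (\sum_(j < n) c j) * w n| <= B * (w 0%N - w n).
  elim: n => [|n IHn]; first by rewrite !big_ord0 mul0r !subrr normr0 mulr0.
  rewrite [X in `|X|](_ : _ = (\sum_(j < n) c j * w j - (\sum_(j < n) c j) * w n)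
     + (\sum_(j < n.+1) c j) * (w n - w n.+1)); last by rewrite !big_ord_recr /=; ring.
  apply: le_trans (ler_normD _ _) _.
  rewrite (_ : B * (w 0%N - w n.+1) = B * (w 0%N - w n) + B * (w n - w n.+1)); last by ring.
  have /andP[_ wn] := wd n.
  by rewrite lerD // normrM (ger0_norm (_ : 0 <= w n - w n.+1)) ?subr_ge0 // ler_wpM2r ?subr_ge0.
move=> h; rewrite -[X in `|X|](subrK ((\sum_(j < n) c j) * w n)).
apply: le_trans (ler_normD _ _) _.
apply: le_trans (lerD h (_ : _ <= B * w n)) _; last by lra.
by rewrite normrM (ger0_norm (w0 n)) ler_wpM2r.
Qed.

Definition int_scale (g : nat) (v : int * int) : int * int := (g%:Z * v.1, g%:Z * v.2).

(** Every nonzero pair is a positive multiple of exactly one primitive pair, and star-shapedness of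
    [S] puts that primitive pair in [S]. *)
Lemma sum_by_lines (V : nmodType) (S : seq (int * int)) (F : int * int -> V) : uniq S ->
  (0, 0) \in S ->
  (forall g v, (0 < g)%N -> int_scale g v \in S -> v \in S) ->
  exists K : nat, \sum_(v <- S) F v =
    F (0, 0) + \sum_(v <- [seq v <- S | coprimez v.1 v.2])
      \sum_(j < K) (if int_scale j.+1 v \in S then F (int_scale j.+1 v) else 0).
Proof.
(* The largest gcd in [S] gives one range of multiples for all lines; multiples that leave [S] count
   as 0. *)
move=> uS S0 starS; pose K := (\max_(v <- S) `|gcdz v.1 v.2|)%N; exists K.
pose P := [seq v <- S | coprimez v.1 v.2].
pose T := [seq v <- [seq int_scale j.+1 v | v <- P, j <- iota 0 K] | v \in S].
have gcdM (g : nat) (a b : int) : gcdz (g%:Z * a) (g%:Z * b) = g%:Z * gcdz a b.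
  by rewrite /gcdz !abszM absz_nat -muln_gcdr PoszM.
have scale_gcd g v : coprimez v.1 v.2 -> `|gcdz (int_scale g v).1 (int_scale g v).2|%N = g.
  rewrite /coprimez => /eqP cv.
  by rewrite -[gcdz _ _]/(gcdz (g%:Z * v.1) (g%:Z * v.2)) gcdM cv mulr1.
rewrite (@big_uniq_eq_mem _ _ S ((0, 0) :: T)) //; last 2 first.
- rewrite cons_uniq; apply/andP; split.
    rewrite mem_filter negb_and; apply/orP; right; apply/negP => /allpairsP[[v j] /= [vP _]].
    move=> /(congr1 (fun w => `|gcdz w.1 w.2|%N)); rewrite scale_gcd //.
    by move: vP; rewrite mem_filter => /andP[].
  apply: filter_uniq; apply: allpairs_uniq; rewrite ?filter_uniq ?iota_uniq //.
  move=> [v i] [w j] /allpairsP[[v' i'] /= [v'P _ [-> ->]]] /allpairsP[[w' j'] /= [w'P _ [-> ->]]] e.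
  move: v'P w'P; rewrite !mem_filter => /andP[cv _] /andP[cw _].
  have ij : i' = j'.
    by have := scale_gcd i'.+1 _ cv; rewrite e scale_gcd // => -[].
  rewrite ij in e *; case: e => e1 e2.
  have inj (a b : int) : j'.+1%:Z * a = j'.+1%:Z * b -> a = b by apply: mulfI.
  by rewrite (surjective_pairing v') (surjective_pairing w') (inj _ _ e1) (inj _ _ e2).
- move=> v; rewrite in_cons mem_filter; have [->|v0] := eqVneq v (0, 0); first by rewrite S0.
  rewrite /=; apply/idP/andP => [vS|[]//]; split=> //.
  pose g := `|gcdz v.1 v.2|%N.
  have g0 : (0 < g)%N.
    rewrite lt0n absz_eq0 gcdz_eq0; apply/negP => /andP[/eqP v1 /eqP v2].
    by case/eqP: v0; rewrite (surjective_pairing v) v1 v2.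
  have gK : (g <= K)%N by rewrite /K (big_rem v vS) /= leq_maxl.
  have gE : gcdz v.1 v.2 = g%:Z by rewrite /g abszE ger0_norm.
  pose w := ((v.1 %/ g)%Z, (v.2 %/ g)%Z).
  have wv : int_scale g w = v.
    rewrite /int_scale /= ![g%:Z * _]mulrC !divzK -?surjective_pairing -?gE ?dvdz_gcdl ?dvdz_gcdr //.
  apply/allpairsP; exists (w, g.-1) => /=; rewrite prednK // wv; split => //.
  + rewrite mem_filter (starS g) ?wv // andbT /coprimez.
    have := congr1 (fun w => gcdz w.1 w.2) wv.
    rewrite -[gcdz (int_scale g w).1 _]/(gcdz (g%:Z * w.1) (g%:Z * w.2)) gcdM gE => /eqP.
    by rewrite -[X in _ == X]mulr1 (inj_eq (mulfI _)) //; lia.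
  + by rewrite mem_iota; lia.
rewrite big_cons; congr (_ + _); rewrite big_filter big_mkcond big_allpairs_dep.
by apply: eq_bigr => v _; rewrite -{1}[K]subn0 -/(index_iota 0 K) big_mkord.
Qed.

End OrbitSums.

(** * The dual lattice sum *)

Section DualSum.
Variable R : realType.
Implicit Types (x y t u : R) (v : int * int).

(** This equals [(-1)^h cos (pi (3 h + 1) l / 3)]: the sign of the theta coefficients times the
    phase of the progression of the [J] modulo 6. *)
Definition line_sign v : R := cos (pi * (3 * v.1 * (1 + v.2) + v.2)%:~R / 3).

(** For [g = j + 1], the angle at [g v] exceeds [g theta] by [pi h l g (g - 1)], a multiple of
    [2 pi] since [g (g - 1)] is even. *)
Lemma line_sign_scale (j : nat) v : let theta := pi * (3 * v.1 * (1 + v.2) + v.2)%:~R / 3 in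
  line_sign (int_scale j.+1 v) = cos (theta + j%:R * theta).
Proof.
have [b e] : exists b : nat, (b%:R : R) = (j%:R + 1) * j%:R / 2.
  exists 'C(j.+1, 2); have := mul_bin_diag j.+1 1; rewrite bin1 => e.
  by apply: (mulIf (_ : 2 != 0 :> R)) => //; rewrite mulfVK // natr1 -!natrM e mulnC.
move=> theta; rewrite /line_sign /theta -[RHS](cosD2pik _ (b%:Z * v.1 * v.2)); congr cos.
have -> : (int_scale j.+1 v).1 = j.+1%:Z * v.1 by [].
have -> : (int_scale j.+1 v).2 = j.+1%:Z * v.2 by [].
by rewrite !(rmorphD, rmorphM) /= -!pmulrn e -[j.+1%:R]natr1 rmorph1; field.
Qed.

(** A parity check: if [l] is odd then [1 + l] is even; if [l] is even then [h] is odd. This oddness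
    keeps the sign sums along a line bounded. *)
Lemma coprimez_odd_form (h l : int) : coprimez h l -> exists k, 3 * h * (1 + l) + l = 2 * k + 1.
Proof.
move=> hl; pose a := (h %/ 2)%Z; pose b := (l %/ 2)%Z.
have hE : h = 2 * a \/ h = 2 * a + 1 by rewrite /a; lia.
have lE : l = 2 * b \/ l = 2 * b + 1 by rewrite /b; lia.
clearbody a b.
case: lE => lE; last by exists (3 * h * (b + 1) + b); rewrite lE; ring.
case: hE => hE; last by exists (3 * a + 6 * a * b + 4 * b + 1); rewrite hE lE; ring.
by move: hl; rewrite hE lE coprimezMl coprimezMr.
Qed.

Lemma line_sign_partial v (n : nat) : coprimez v.1 v.2 ->
  `|\sum_(j < n) line_sign (int_scale j.+1 v)| <= 2.
Proof.
move=> /coprimez_odd_form[k ck].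
under eq_bigr do rewrite line_sign_scale ck.
set theta := pi * _ / 3.
have s2 := odd_angle_sin R k; rewrite -/theta in s2.
have := congr1 Num.norm (sum_cos_arith theta theta n); rewrite normrM normrM normr_nat => e.
have : `|\sum_(j < n) cos (theta + j%:R * theta)| * (2 * `|sin (theta / 2)|) <= 2.
  rewrite e; apply: le_trans (ler_normB _ _) _.
  by apply: le_trans (lerD (sin_max _) (sin_max _)) _.
have := normr_ge0 (\sum_(j < n) cos (theta + j%:R * theta)); nra.
Qed.

(** The Fourier transform of the binomial weight is a power of a cosine, here in place of a Gaussian
    in [3 h x + l]. *)
Definition dual_kernel x y (L m : nat) v : R :=
  expR (- (3 * y * v.1%:~R ^+ 2 / 4)) * cos (pi * (3 * v.1%:~R * x + v.2%:~R) / L%:R) ^+ m.*2.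

Lemma dual_kernel_ge0 x y L m v : 0 <= dual_kernel x y L m v.
Proof. by rewrite mulr_ge0 ?expR_ge0 // exprn_even_ge0 // odd_double. Qed.

(** The least [l] with [3 h x + l >= - L / 2]. The box takes for each [h] one period of [L] values
    of [l], placed so that the angle in [dual_kernel] lies in [[- pi / 2, pi / 2)]. *)
Definition dual_window x (L : nat) (h : int) : int := Num.ceil (- (L%:R / 2) - 3 * h%:~R * x).

Definition dual_box x (L H : nat) : seq (int * int) :=
  [seq (h, dual_window x L h + j%:Z) | h <- int_ball H, j <- iota 0 L].

Lemma mem_dual_box x L H v : (v \in dual_box x L H) =
  (`|v.1| <= H)%N && (- (L%:R / 2) <= 3 * v.1%:~R * x + v.2%:~R < L%:R / 2).
Proof.
case: v => h l /=; set a := L%:R / 2 : R; have La : L%:R = a + a by rewrite /a; field.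
apply/allpairsP/andP => [[[h' j] /= [hH jL [-> ->]]]|[hH /andP[t1 t2]]].
  rewrite mem_int_ball in hH; split => //.
  have := @ceil_ge R (- a - 3 * h'%:~R * x); have := @ceilB1_lt R (- a - 3 * h'%:~R * x).
  rewrite -/(dual_window x L h') !rmorphD /= rmorphN1 => h1 h2.
  have j1 : (j%:R : R) + 1 <= L%:R by rewrite natr1 ler_nat; move: jL; rewrite mem_iota; lia.
  by have : 0 <= (j%:R : R) by []; rewrite -pmulrn => j0; apply/andP; split; lra.
have w1 : dual_window x L h <= l by rewrite ceil_le_int; lra.
have w2 : l - L%:Z < dual_window x L h.
  rewrite ceil_gt_int rmorphB /= -pmulrn La -/a; lra.
exists (h, `|(l - dual_window x L h)%R|%N); split => /=; rewrite ?mem_int_ball ?mem_iota //; first by lia.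
by congr (_, _); lia.
Qed.

Lemma uniq_dual_box x L H : uniq (dual_box x L H).
Proof.
apply: allpairs_uniq; rewrite ?uniq_int_ball ?iota_uniq //.
by move=> [h j] [h' j'] _ _ /= [-> /addrI [->]].
Qed.

(** With [u = pi t / L], the hypothesis on [L] and [pi^2 >= 4] give [4 t^2 <= 3 y m u^2], so the
    exponent [m u^2 / 5] of [cos_sqr_gauss] dominates [t^2 / (4 y)]. *)
Lemma dual_kernel_gauss x y (L m : nat) v : 0 < y -> (0 < L)%N ->
  L%:R ^+ 2 <= 3 * y * m%:R -> `|3 * v.1%:~R * x + v.2%:~R| <= L%:R / 2 ->
  dual_kernel x y L m v <= lattice_gauss (3 * x) y v.
Proof.
move=> y0 L0 Lm; rewrite /dual_kernel /lattice_gauss.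
rewrite (_ : v.1%:~R * (3 * x) = 3 * v.1%:~R * x); last by ring.
set t := 3 * _ * x + _ => tL.
have Lp : 0 < (L%:R : R) by rewrite ltr0n.
set u := pi * t / L%:R.
have uh : `|u| <= pi / 2.
  rewrite /u -mulrA normrM (ger0_norm (pi_ge0 R)) ler_wpM2l ?pi_ge0 //.
  by rewrite normrM normfV (gtr0_norm Lp) ler_pdivrMr // mulrC.
rewrite -mul2n exprM.
apply: le_trans (_ : _ <= expR (- (3 * y * v.1%:~R ^+ 2 / 4)) * expR (- (u ^+ 2 / 5)) ^+ m) _.
  by rewrite ler_wpM2l ?expR_ge0 // lerXn2r ?nnegrE ?sqr_ge0 ?expR_ge0 // cos_sqr_gauss.
rewrite -expRM_natl -expRD ler_expR.
have h2 := sqr_ge0 (v.1%:~R : R).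
have key : t ^+ 2 / y / 4 <= m%:R * (u ^+ 2 / 5).
  have u2 : u ^+ 2 * L%:R ^+ 2 = pi ^+ 2 * t ^+ 2 by rewrite /u; field; rewrite gt_eqF.
  have pi4 : 4 <= (pi : R) ^+ 2 by have := @pi_ge2 R; nra.
  have t2 := sqr_ge0 t; have uu := sqr_ge0 u.
  rewrite ler_pdivrMr // ler_pdivrMr //.
  have : 4 * t ^+ 2 <= u ^+ 2 * (3 * y * m%:R).
    apply: le_trans (_ : u ^+ 2 * L%:R ^+ 2 <= _); last by rewrite ler_wpM2l.
    by rewrite u2 ler_wpM2r.
  nra.
rewrite (_ : - _ / 4 = - (y * v.1%:~R ^+ 2 / 4) - (t ^+ 2 / y / 4)); last by field; rewrite gt_eqF.
nra.
Qed.

(** The angles stay in [[0, pi / 2]], where the cosine decreases; this gives the monotone weights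
    for summation by parts along a line. *)
Lemma dual_kernel_scale x y (L m : nat) v (g g' : nat) : 0 <= y -> (0 < L)%N -> (g <= g')%N ->
  g'%:R * `|3 * v.1%:~R * x + v.2%:~R| <= L%:R / 2 ->
  dual_kernel x y L m (int_scale g' v) <= dual_kernel x y L m (int_scale g v).
Proof.
move=> y0 L0 gg; set t := 3 * _ * x + _ => tL.
have Lp : 0 < (L%:R : R) by rewrite ltr0n.
have E k : dual_kernel x y L m (int_scale k v) =
    expR (- (3 * y * (k%:R * v.1%:~R) ^+ 2 / 4)) * cos (pi * (k%:R * `|t|) / L%:R) ^+ m.*2.
  rewrite /dual_kernel.
  have -> : (int_scale k v).1%:~R = k%:R * v.1%:~R :> R by rewrite rmorphM.
  have -> : (int_scale k v).2%:~R = k%:R * v.2%:~R :> R by rewrite rmorphM.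
  rewrite (_ : 3 * (k%:R * _) * x + _ = k%:R * t); last by rewrite /t; ring.
  rewrite -[cos (pi * (k%:R * t) / _)]cos_norm; congr (_ * cos _ ^+ _).
  by rewrite -mulrA normrM (ger0_norm (pi_ge0 R)) normrM normrM (ger0_norm (ler0n _ k)) normfV (gtr0_norm Lp) mulrA.
have gR : (g%:R : R) <= g'%:R by rewrite ler_nat.
have bnd k : (k <= g')%N -> 0 <= pi * (k%:R * `|t|) / L%:R <= pi / 2.
  move=> kg; rewrite !mulr_ge0 ?pi_ge0 ?invr_ge0 // -mulrA ler_wpM2l ?pi_ge0 //.
  rewrite ler_pdivrMr // [_^-1 * _]mulrC; apply: le_trans tL.
  by rewrite ler_wpM2r // ler_nat.
have /andP[b1 b2] := bnd g gg; have /andP[b3 b4] := bnd g' (leqnn _).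
have pi0 := pi_ge0 R.
have c0 : 0 <= cos (pi * (g'%:R * `|t|) / L%:R) by apply: cos_ge0_pihalf; apply/andP; split; lra.
rewrite !E; apply: ler_pM; rewrite ?expR_ge0 ?exprn_ge0 //.
  rewrite ler_expR lerN2 ler_wpM2r ?invr_ge0 // ler_wpM2l ?mulr_ge0 //.
  rewrite !exprMn ler_wpM2r ?sqr_ge0 // lerXn2r ?nnegrE //.
have cc : cos (pi * (g'%:R * `|t|) / L%:R) <= cos (pi * (g%:R * `|t|) / L%:R).
  rewrite leNgt ltr_cos ?in_itv /=; try by (apply/andP; split; lra).
  by rewrite -leNgt ler_wpM2r ?invr_ge0 // ler_wpM2l // ler_wpM2r.
by rewrite lerXn2r ?nnegrE // (le_trans c0).
Qed.

Lemma dual_sum_bound x y (L m H : nat) : 0 < y -> (0 < L)%N -> L%:R ^+ 2 <= 3 * y * m%:R ->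
  `|\sum_(v <- dual_box x L H) line_sign v * dual_kernel x y L m v| <= 72 ^+ 2.
Proof.
move=> y0 L0 Lm; set S := dual_box x L H.
have Lp : 0 < (L%:R : R) by rewrite ltr0n.
have tE (g : nat) v : 3 * (int_scale g v).1%:~R * x + (int_scale g v).2%:~R =
    g%:R * (3 * v.1%:~R * x + v.2%:~R).
  have -> : (int_scale g v).1%:~R = g%:R * v.1%:~R :> R by rewrite rmorphM.
  have -> : (int_scale g v).2%:~R = g%:R * v.2%:~R :> R by rewrite rmorphM.
  by ring.
have star (g g' : nat) v : (0 < g <= g')%N -> int_scale g' v \in S -> int_scale g v \in S.
  move=> /andP[g0 gg]; rewrite !mem_dual_box !tE => /andP[gH /andP[t1 t2]].
  have gR : (g%:R : R) <= g'%:R by rewrite ler_nat.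
  have g1 : 0 < (g%:R : R) by rewrite ltr0n.
  apply/andP; split.
    by apply: leq_trans gH; rewrite !abszM !absz_nat leq_mul2r gg orbT.
  move: t1 t2; set t := 3 * _ * x + _ => t1 t2.
  by have [t0|t0] := leP 0 t; apply/andP; split; nra.
have inS v : v \in S -> `|3 * v.1%:~R * x + v.2%:~R| <= L%:R / 2.
  by rewrite mem_dual_box => /andP[_ /andP[t1 t2]]; rewrite ler_norml t1 ltW.
have scale1 v : int_scale 1 v = v by rewrite /int_scale !mul1r -surjective_pairing.
have S0 : (0, 0) \in S.
  by rewrite mem_dual_box /= mulr0 mul0r addr0; apply/andP; split; lra.
have [|K ->] := @sum_by_lines R S (fun v => line_sign v * dual_kernel x y L m v)
    (uniq_dual_box x L H) S0.
  by move=> g v g0 gS; rewrite -(scale1 v); apply: star gS; rewrite g0.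
apply: le_trans (ler_normD _ _) _.
(* The origin contributes at most 1, each line at most twice its first term, and the first terms add
   up to at most [50^2]. *)
apply: le_trans (_ : _ <= 1 + 2 * 50 ^+ 2) _; last by lra.
apply: lerD.
  rewrite /line_sign /dual_kernel (_ : 3 * (0, 0).1 * _ + _ = 0 :> int) //.
  rewrite [(0, 0).1]/= [(0, 0).2]/= expr0n /= !(mulr0, mul0r) addr0 mulr0 !mul0r.
  by rewrite oppr0 expR0 cos0 expr1n !mulr1 normr1.
set P := [seq v <- S | _].
apply: le_trans (ler_norm_sum _ _ _) _.
apply: le_trans (_ : _ <= \sum_(v <- P) 2 * lattice_gauss (3 * x) y v) _; last first.
  rewrite -mulr_sumr ler_wpM2l // lattice_gauss_sum ?filter_uniq ?uniq_dual_box //.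
  by move=> v; rewrite mem_filter => /andP[].
rewrite big_seq [leRHS]big_seq; apply: ler_sum => v; rewrite mem_filter => /andP[cv vS].
pose w j := if int_scale j.+1 v \in S then dual_kernel x y L m (int_scale j.+1 v) else 0.
rewrite (eq_bigr (fun j : 'I_K => line_sign (int_scale j.+1 v) * w j)); last first.
  by move=> j _; rewrite /w; case: ifP => // _; rewrite mulr0.
have ab := @abel_bound R (fun j => line_sign (int_scale j.+1 v)) w 2 K
  (fun n => line_sign_partial n cv).
apply: le_trans (ab _) _.
  (* Cutting off at the box keeps the weights nonincreasing: by [star], a line that has left the box
     does not return. *)
  move=> j; rewrite /w; case: ifP => [jS|_]; last by case: ifP; rewrite ?lexx ?dual_kernel_ge0.
  rewrite dual_kernel_ge0 andTb ifT; last by apply: star jS; rewrite leqnSn.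
  apply: dual_kernel_scale => //; first exact: ltW.
  by have := inS _ jS; rewrite tE normrM (ger0_norm (ler0n _ _)).
rewrite ler_wpM2l // /w scale1 vS; apply: dual_kernel_gauss => //; exact: inS.
Qed.

End DualSum.

(** * Poisson summation and the cusp bound *)

Section PoissonSummation.
Variable R : realType.
Implicit Types (x y : R) (h k A : int).

(* The binomial analogue of Poisson summation for a Gaussian with a linear phase: both sides
   sample the Fourier expansion of [(2 cos)^(2m)], along a residue class modulo [6N] on the
   left and along the [6N]-th roots of unity on the right. *)
Lemma binomial_poisson (m N W : nat) (h A : int) x : (0 < N)%N -> (m + `|h| + 1 <= W)%N ->
  (6 * N)%:R * \sum_(k <- int_ball W) (cbin m (N%:Z * (3 * (h + 2 * k) + 1)))%:R *
     cos (pi * h%:~R * x * (3 * (h + 2 * k) + 1)%:~R) =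
  \sum_(j < 6 * N) cos (pi * ((3 * h + 1) * (A + j%:Z))%:~R / 3) *
     (2 * cos (pi * (3 * h%:~R * x + (A + j%:Z)%:~R) / (6 * N)%:R)) ^+ m.*2.
Proof.
move=> N0 mW; set L := (6 * N)%N.
have L0 : (0 < L)%N by rewrite muln_gt0.
have LR0 : (L%:R : R) != 0 by rewrite pnatr_eq0 -lt0n.
have NR0 : (N%:R : R) != 0 by rewrite pnatr_eq0 -lt0n.
have LN : (L%:R : R) = 6 * N%:R by rewrite /L natrM.
have LE : L = (6 * N)%N by [].
clearbody L.
(* [d i] is divisible by [L = 6 N] exactly when [i = N (3 (h + 2 k) + 1)] for an integer [k]. *)
pose d (i : int) := i - N%:Z * (3 * h + 1).
pose phi (i : int) : R := 2 * pi * i%:~R * 3 * h%:~R * x / L%:R + A%:~R * (2 * pi * (d i)%:~R / L%:R).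
(* The right side with the cosine power expanded and the sums exchanged; the inner sum is then a
   filter on [d i]. *)
transitivity (\sum_(i <- int_ball m) (cbin m i)%:R * \sum_(j < L)
    cos (phi i + j%:R * (2 * pi * (d i)%:~R / L%:R))); last first.
  under eq_bigr do rewrite mulr_sumr; rewrite exchange_big /=; apply: eq_bigr => j _.
  rewrite -[cos (pi * _ / 3)]cosN cos_mul_2cosXdouble; apply: eq_bigr => i _.
  congr (_ * cos _); rewrite /phi /d !(rmorphD, rmorphM, rmorphN) /= -!pmulrn LN rmorph1; field.
  by rewrite NR0.
have phiE i : (L %| d i)%Z -> cos (phi i) = cos (pi * h%:~R * x * i%:~R / N%:R).
  move=> /dvdzP[q dq]; rewrite -[RHS](cosD2pik _ (A * q)); congr cos.
  by rewrite /phi dq !rmorphM /= -!pmulrn LN; field.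
transitivity (\sum_(i <- int_ball m | (L %| d i)%Z)
    (cbin m i)%:R * (L%:R * cos (pi * h%:~R * x * i%:~R / N%:R))); last first.
  rewrite big_mkcond; apply: eq_bigr => i _; rewrite root_of_unity_filter //.
  by case: ifP => [Ld|_]; rewrite ?mulr0 // phiE.
pose G k := N%:Z * (3 * (h + 2 * k) + 1).
have Ginj : injective G by move=> k k'; rewrite /G; nia.
(* [W] reaches every [k] with [|G k| <= m], and the remaining [k] carry a zero binomial
   coefficient. *)
rewrite mulr_sumr (bigID (fun k => (`|G k| <= m)%N)) /= [X in _ + X]big1 ?addr0; last first.
  move=> k; rewrite -ltnNge -[N%:Z * _]/(G k) => mG.
  by rewrite /cbin bin_small ?mul0r ?mulr0 // -addnn ltn_add2l.
rewrite -big_filter -[RHS]big_filter.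
rewrite [RHS](@big_uniq_eq_mem _ _ _ [seq G k | k <- [seq k <- int_ball W | (`|G k| <= m)%N]]); first last.
- move=> i; rewrite mem_filter mem_int_ball; apply/andP/mapP => [[/dvdzP[q dq] im]|[k]].
    have iE : i = G q by rewrite /G; move: dq; rewrite /d LE; lia.
    exists q => //; rewrite mem_filter -iE im mem_int_ball /=.
    by move: im; rewrite iE /G; nia.
  rewrite mem_filter mem_int_ball => /andP[Gm kW] ->; split => //.
  by apply/dvdzP; exists k; rewrite /d /G LE; lia.
- by rewrite map_inj_uniq // filter_uniq // uniq_int_ball.
- by rewrite filter_uniq // uniq_int_ball.
rewrite big_map; apply: eq_bigr => k _; rewrite mulrCA; congr (_ * (_ * cos _)).
by rewrite /G rmorphM /= -pmulrn; field.
Qed.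

(** The double sum for [|f|^2] in the variables [h] and [J = 3 (h + 2 k) + 1], with the Gaussian in
    [J] replaced by a normalized binomial weight at [N J]. *)
Definition smooth_sum x y (N m H W : nat) : R :=
  \sum_(h <- int_ball H) \sum_(k <- int_ball W)
    (-1) ^+ `|h| * expR (- (3 * y * h%:~R ^+ 2 / 4)) *
    ((cbin m (N%:Z * (3 * (h + 2 * k) + 1)))%:R / (cbin m 0)%:R) *
    cos (pi * h%:~R * x * (3 * (h + 2 * k) + 1)%:~R).

Lemma smooth_sum_dual x y (N m H W : nat) : (0 < N)%N -> (m + H + 1 <= W)%N ->
  (6 * N)%:R * (cbin m 0)%:R * smooth_sum x y N m H W =
  4 ^+ m * \sum_(v <- dual_box x (6 * N) H) line_sign R v * dual_kernel x y (6 * N) m v.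
Proof.
move=> N0 mW; set L := (6 * N)%N.
have c0 : ((cbin m 0)%:R : R) != 0 by rewrite pnatr_eq0 -lt0n bin_gt0; lia.
rewrite /dual_box big_allpairs_dep /smooth_sum !mulr_sumr big_seq [RHS]big_seq.
apply: eq_bigr => h; rewrite mem_int_ball => hH.
have hW : (m + `|h| + 1 <= W)%N by lia.
have e := binomial_poisson (dual_window x L h) x N0 hW; rewrite -/L in e.
have iotaE (F : nat -> R) : \sum_(j <- iota 0 L) F j = \sum_(j < L) F j.
  by rewrite -(big_mkord xpredT) /index_iota subn0.
rewrite [X in _ = _ * X]iotaE.
transitivity ((-1) ^+ `|h| * expR (- (3 * y * h%:~R ^+ 2 / 4)) * (L%:R *
  \sum_(k <- int_ball W) (cbin m (N%:Z * (3 * (h + 2 * k) + 1)))%:R *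
     cos (pi * h%:~R * x * (3 * (h + 2 * k) + 1)%:~R))).
  by rewrite !mulr_sumr; apply: eq_bigr => k _; field.
rewrite e !mulr_sumr; apply: eq_bigr => j _.
rewrite /line_sign /dual_kernel /= exprMn -mul2n exprM (_ : 2 ^+ 2 = 4); last by ring.
set l := dual_window x L h + j%:Z.
(* The sign [(-1)^h] is a shift of the angle by [pi h], which turns the linear phase into
   [line_sign]. *)
have -> : cos (pi * (3 * h * (1 + l) + l)%:~R / 3) =
    (-1) ^+ `|h| * cos (pi * ((3 * h + 1) * l)%:~R / 3) :> R.
  by rewrite -cosDpik; congr cos; rewrite !(rmorphD, rmorphM) /= rmorph1; field.
ring.
Qed.

(** The lower bound on [y m] is the hypothesis [L^2 <= 3 y m] of the dual estimate at [L = 6 N]; the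
    upper bound and [central_bin_lower] make the dual prefactor at most [2 / sqrt y]. *)
Lemma smooth_sum_bound x y (N m H W : nat) : (0 < N)%N -> (0 < m)%N -> (m + H + 1 <= W)%N -> 0 < y ->
  12 * N%:R ^+ 2 <= y * m%:R -> y * m%:R <= 24 * N%:R ^+ 2 ->
  `|smooth_sum x y N m H W| <= 2 * 72 ^+ 2 / Num.sqrt y.
Proof.
move=> N0 m0 mW y0 h1 h2; set L := (6 * N)%N.
have L0 : (0 < L)%N by rewrite muln_gt0.
have Np : 0 < (N%:R : R) by rewrite ltr0n.
have LN : (L%:R : R) = 6 * N%:R by rewrite /L natrM.
have c0 : 0 < ((cbin m 0)%:R : R) by rewrite ltr0n bin_gt0; lia.
have Lc : 0 < L%:R * (cbin m 0)%:R :> R by rewrite mulr_gt0 // ltr0n.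
have s0 : 0 < Num.sqrt y by rewrite sqrtr_gt0.
have q4 : 4 ^+ m * Num.sqrt y <= 2 * (L%:R * (cbin m 0)%:R).
  rewrite -ler_sqr ?nnegrE ?mulr_ge0 ?exprn_ge0 ?sqrtr_ge0 ?ler0n //.
  rewrite exprMn sqr_sqrtr ?(ltW y0) // -exprM mulnC exprM (_ : 4 ^+ 2 = 16); last by ring.
  have : (16 ^+ m : R) <= 4 * m%:R * (cbin m 0)%:R ^+ 2.
    by rewrite -!natrX -!natrM ler_nat /cbin addn0; exact: central_bin_lower.
  move=> /(ler_wpM2r (ltW y0)) h; apply: le_trans h _.
  rewrite LN; set c := (cbin m 0)%:R ^+ 2.
  rewrite (_ : _ * c * y = 4 * (y * m%:R) * c); last by ring.
  rewrite (_ : _ ^+ 2 = 144 * N%:R ^+ 2 * c); last by rewrite /c; ring.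
  by rewrite ler_wpM2r ?sqr_ge0 //; lra.
have Lm : L%:R ^+ 2 <= 3 * y * m%:R by rewrite LN; lra.
have := congr1 Num.norm (@smooth_sum_dual x y N m H W N0 mW); rewrite -/L.
rewrite normrM (gtr0_norm Lc) normrM (ger0_norm (exprn_ge0 m (ler0n R 4))) => e.
rewrite ler_pdivlMr // -(ler_pM2l Lc) mulrA e mulrAC.
apply: le_trans (ler_pM _ _ q4 (dual_sum_bound x H y0 L0 Lm)) _ => //.
by rewrite [leRHS]mulrCA [leRHS]mulrA lexx.
Qed.

End PoissonSummation.

(** * The theta series and its cusp estimate *)

Section ThetaBound.
Variable R : realType.
Implicit Types (x y phi : R) (h k : int) (M : nat).

Definition pent_real k : R := (k * (3 * k + 1))%:~R / 2.

(** The real part of [e^(i phi)] times a partial sum of [f] at [x + i y / (2 pi)]; the free phase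
    covers real and imaginary parts together. *)
Definition theta_partial M x y phi : R :=
  \sum_(k <- int_ball M) (-1) ^+ `|k| * expR (- (y * pent_real k)) *
    cos (2 * pi * pent_real k * x + phi).

Lemma signrZ_sub k k' : (-1) ^+ `|k| * (-1) ^+ `|k'| = (-1) ^+ `|k - k'|%N :> R.
Proof.
by rewrite -exprD -signr_odd -[RHS]signr_odd; congr (_ ^+ nat_of_bool _); lia.
Qed.

Definition smooth_term (w : int -> R) x y h k : R :=
  (-1) ^+ `|h| * expR (- (3 * y * h%:~R ^+ 2 / 4)) * w (3 * (h + 2 * k) + 1) *
  cos (pi * h%:~R * x * (3 * (h + 2 * k) + 1)%:~R).

(** Adding the square of the sine sum gives [|f|^2]. With [h = k1 - k] and [J = 3 (k1 + k) + 1], the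
    exponents have sum [3 h^2 / 4 + J^2 / 12 - 1 / 12] and difference [h J / 2]. *)
Lemma theta_partial_sqr M x y phi : theta_partial M x y phi ^+ 2 <=
  expR (y / 12) * \sum_(k <- int_ball M) \sum_(k1 <- int_ball M)
    smooth_term (fun J => expR (- (y * J%:~R ^+ 2 / 12))) x y (k1 - k) k.
Proof.
pose c k : R := (-1) ^+ `|k| * expR (- (y * pent_real k)).
pose th k : R := 2 * pi * pent_real k * x + phi.
apply: le_trans (_ : _ <= theta_partial M x y phi ^+ 2 +
  (\sum_(k <- int_ball M) c k * sin (th k)) ^+ 2) _; first by rewrite lerDl sqr_ge0.
rewrite /theta_partial !expr2 !mulr_suml mulr_sumr -big_split /= le_eqVlt; apply/orP; left; apply/eqP.
apply: eq_bigr => k _; rewrite !mulr_sumr -big_split /=; apply: eq_bigr => k1 _.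
rewrite -/(c k) -/(c k1) -/(th k) -/(th k1) /smooth_term.
transitivity (c k1 * c k * cos (th k1 - th k)); first by rewrite cosB; ring.
have -> : c k1 * c k = (-1) ^+ `|k1 - k|%N * expR (- (y * pent_real k1) - y * pent_real k).
  by rewrite -signrZ_sub expRD /c; ring.
have -> : 3 * (k1 - k + 2 * k) + 1 = 3 * (k1 + k) + 1 by ring.
have -> : - (y * pent_real k1) - y * pent_real k =
    y / 12 + - (3 * y * (k1 - k)%:~R ^+ 2 / 4) + - (y * (3 * (k1 + k) + 1)%:~R ^+ 2 / 12).
  by rewrite /pent_real !(rmorphD, rmorphM, rmorphN) /= rmorph1; field.
have -> : th k1 - th k = pi * (k1 - k)%:~R * x * (3 * (k1 + k) + 1)%:~R.
  by rewrite /th /pent_real !(rmorphD, rmorphM, rmorphN) /= rmorph1; field.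
by rewrite !expRD; ring.
Qed.

(** The least [m] with [y m > 12 N^2], the scale at which [exp (- (N J)^2 / m)] approaches
    [exp (- y J^2 / 12)]. *)
Definition gauss_index y (N : nat) : nat := (Num.truncn (12 * N%:R ^+ 2 / y)).+1.

Lemma gauss_index_bounds y (N : nat) : 0 < y -> 
  12 * N%:R ^+ 2 < y * (gauss_index y N)%:R <= 12 * N%:R ^+ 2 + y.
Proof.
move=> y0; rewrite -ltr_pdivrMl // mulrC truncnS_gt /gauss_index -natr1 mulrDr mulr1 lerD2r.
by rewrite -ler_pdivlMl // [leRHS]mulrC truncn_le divr_ge0 ?mulr_ge0 ?sqr_ge0 // ltW.
Qed.

Definition binomial_weight y (N : nat) (J : int) : R :=
  (cbin (gauss_index y N) (N%:Z * J))%:R / (cbin (gauss_index y N) 0)%:R.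

(** Squeezed between [cbin_lower] and [cbin_upper] at [a N] with [a = |J|], since [m / N^2] tends to
    [12 / y]. *)
Lemma binomial_weight_cvg y J : 0 < y <= 1 ->
  binomial_weight y n.+1 J @[n --> \oo] --> expR (- (y * J%:~R ^+ 2 / 12)).
Proof.
move=> /andP[y0 y1]; pose m n := gauss_index y n.+1; pose r n : R := (m n)%:R / n.+1%:R ^+ 2.
have cr : r n @[n --> \oo] --> 12 / y.
  apply: (@squeeze_cvgr _ _ _ _ (fun=> 12 / y) (fun n => 12 / y + harmonic n)).
  - apply: nearW => n; have /andP[h1 h2] := gauss_index_bounds n.+1 y0.
    have n0 : 0 < (n.+1%:R : R) ^+ 2 by rewrite exprn_gt0.
    have n1 : 1 <= (n.+1%:R : R) by rewrite ler1n.
    rewrite /r ler_pdivlMr // mulrAC ler_pdivrMr // [_ * y]mulrC (ltW h1) /=.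
    rewrite ler_pdivrMr // -(ler_pM2l y0); apply: le_trans h2 _.
    have -> : y * ((12 / y + harmonic n) * n.+1%:R ^+ 2) = 12 * n.+1%:R ^+ 2 + y * n.+1%:R.
      have N0 : (n.+1%:R : R) != 0 by [].
      by rewrite /harmonic /=; move: (n.+1%:R : R) N0 => N N0; field; rewrite ?N0 ?gt_eqF.
    by rewrite lerD2l ler_peMr // ltW.
  - exact: cvg_cst.
  - by rewrite -[X in _ --> X]addr0; apply: cvgD; [exact: cvg_cst|exact: cvg_harmonic].
set a := `|J|%N.
have aE : (a%:R : R) ^+ 2 = J%:~R ^+ 2 by rewrite /a natr_absz intr_norm real_normK ?num_real.
(* Common shape of both bounds after division by [N^2]: the denominators [m - a N + 1] and [m + a N]
   correspond to [sg = -1] and [sg = 1]. *)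
have cup (sg : R) (e : nat -> R) : e n @[n --> \oo] --> 0 ->
    expR (- (a%:R ^+ 2 / (r n + sg * a%:R * harmonic n + e n))) @[n --> \oo] -->
    expR (- (y * J%:~R ^+ 2 / 12)).
  move=> ce; apply: continuous_cvg; first exact: continuous_expR.
  apply: cvgN; rewrite (_ : y * J%:~R ^+ 2 / 12 = a%:R ^+ 2 * (12 / y)^-1); last first.
    by rewrite aE invf_div; ring.
  apply: cvgM; first exact: cvg_cst.
  apply: cvgV; first by rewrite gt_eqF // divr_gt0.
  rewrite -[X in _ --> X]addr0; apply: cvgD => //.
  rewrite -[X in _ --> X]addr0; apply: cvgD => //.
  rewrite -[X in _ --> X](mulr0 (sg * a%:R)); apply: cvgM; [exact: cvg_cst|exact: cvg_harmonic].
have hh : (harmonic n : R) ^+ 2 @[n --> \oo] --> 0.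
  by rewrite -[X in _ --> X](mulr0 0); apply: cvgM; exact: cvg_harmonic.
apply: squeeze_cvgr (cup (-1) _ hh) (cup 1 (fun=> 0) (cvg_cst _)).
exists a => // n /= an.
have c0 : 0 < ((cbin (m n) 0)%:R : R) by rewrite ltr0n bin_gt0 addn0 -addnn leq_addr.
have Np : 0 < (n.+1%:R : R) by rewrite ltr0n.
have an2 : (a * n.+1 <= m n)%N.
  have /andP[h _] := gauss_index_bounds n.+1 y0.
  have {}h : 12 * n.+1%:R ^+ 2 < (m n)%:R :> R.
    by apply: lt_le_trans h _; rewrite ler_piMl // ltW.
  have aN : (a%:R : R) <= n.+1%:R by rewrite ler_nat ltnW.
  rewrite -(ler_nat R) natrM; have : 0 <= (a%:R : R) by []; nra.
have bwE : binomial_weight y n.+1 J = (cbin (m n) (a * n.+1)%N)%:R / (cbin (m n) 0)%:R.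
  by rewrite /binomial_weight /cbin abszM !absz_nat mulnC.
rewrite bwE; apply/andP; split.
  rewrite ler_pdivlMr // mulrC; apply: le_trans (cbin_lower R an2).
  rewrite ler_wpM2l // ler_expR lerN2 le_eqVlt; apply/orP; left; apply/eqP.
  have : 0 < (m n)%:R - (a * n.+1)%:R + 1 :> R.
    by rewrite ltr_wpDl ?subr_ge0 // ler_nat.
  rewrite /r /harmonic /= natrM; set N := n.+1%:R in Np *; set M := (m n)%:R; clearbody N M => p0.
  have -> : M / N ^+ 2 + -1 * a%:R * N^-1 + N^-1 ^+ 2 = (M - a%:R * N + 1) / N ^+ 2.
    by field; rewrite gt_eqF.
  by field; rewrite ?(gt_eqF p0) ?(gt_eqF Np).
rewrite ler_pdivrMr // [leRHS]mulrC; apply: le_trans (cbin_upper R an2) _.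
rewrite ler_wpM2l // ler_expR lerN2 le_eqVlt; apply/orP; left; apply/eqP.
have : 0 < (m n)%:R + (a * n.+1)%:R :> R by rewrite -natrD ltr0n.
rewrite /r /harmonic /= natrM; set N := n.+1%:R in Np *; set M := (m n)%:R; clearbody N M => p0.
have -> : M / N ^+ 2 + 1 * a%:R * N^-1 + 0 = (M + a%:R * N) / N ^+ 2.
  by field; rewrite gt_eqF.
by field; rewrite ?(gt_eqF p0) ?(gt_eqF Np).
Qed.

(** The exponent is at least [y (k^2 + k1^2) / 6]. Outside the box half of it pays for [M^2] and the
    other half gives summable factors; each of the three exponentials costs a factor [12 / y]. *)
Lemma gauss_box_decay y (N M : nat) k k1 : 0 < y <= 1 -> (0 < N)%N -> (0 < M)%N ->
  ~~ ((`|k| <= M) && (`|k1| <= M))%N ->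
  expR (- (3 * y * (k1 - k)%:~R ^+ 2 / 4)) * binomial_weight y N (3 * (k1 + k) + 1) <=
  12 ^+ 3 / (y ^+ 3 * M%:R ^+ 2) * ((1 + k1%:~R ^+ 2)^-1 * (1 + k%:~R ^+ 2)^-1).
Proof.
move=> /andP[y0 y1] N0 M0 out; set J := 3 * (k1 + k) + 1; set m := gauss_index y N.
have Np : 1 <= (N%:R : R) by rewrite ler1n.
have Mp : 0 < (M%:R : R) by rewrite ltr0n.
have m0 : 0 < (m%:R : R) by rewrite ltr0n.
have c0 : 0 < ((cbin m 0)%:R : R) by rewrite ltr0n bin_gt0 addn0 -addnn leq_addr.
have /andP[_ mN] := gauss_index_bounds N y0; rewrite -/m in mN.
set a := (k%:~R : R); set b := (k1%:~R : R).
have J4 : 4 * (b + a) ^+ 2 <= (J%:~R : R) ^+ 2.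
  have : (4 * (k1 + k) ^+ 2 <= J ^+ 2)%R by rewrite /J; nia.
  by rewrite -(ler_int R) intrM !rmorphXn /= intrD.
have w1 : binomial_weight y N J <= expR (- (y * J%:~R ^+ 2 / 48)).
  rewrite /binomial_weight -/m ler_pdivrMr // [leRHS]mulrC.
  have m0n : (0 < m)%N by [].
  apply: le_trans (cbin_gauss R _ m0n) _; rewrite ler_wpM2l // ler_expR lerN2.
  rewrite rmorphM /= -pmulrn exprMn; have := sqr_ge0 (J%:~R : R); set q := J%:~R ^+ 2 => q0.
  rewrite ler_pdivlMr ?mulr_gt0 //.
  have : y * m%:R <= 24 * N%:R ^+ 2 by nra.
  nra.
have decay (t z : R) : 0 <= z -> 0 <= t -> expR (- (z * t)) <= (1 + z * t)^-1.
  move=> z0 t0; rewrite expRN lef_pV2 ?posrE ?expR_gt0 ?expR_ge1Dx //.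
  by rewrite ltr_pwDl ?mulr_ge0.
have a2 := sqr_ge0 a; have b2 := sqr_ge0 b.
have far : M%:R ^+ 2 <= a ^+ 2 + b ^+ 2.
  have sq (c : int) : (M < `|c|)%N -> M%:R ^+ 2 <= (c%:~R : R) ^+ 2.
    move=> Mc; rewrite -(real_normK (num_real (c%:~R : R))) -intr_norm -natr_absz.
    by rewrite lerXn2r ?nnegrE // ler_nat ltnW.
  by move: out; rewrite negb_and -!ltnNge => /orP[/sq|/sq]; rewrite -/a -/b => h; lra.
apply: le_trans (_ : _ <= expR (- (y / 12 * M%:R ^+ 2)) * (expR (- (y / 12 * b ^+ 2)) * expR (- (y / 12 * a ^+ 2)))) _.
  apply: le_trans (ler_wpM2l (expR_ge0 _) w1) _.
  rewrite -!expRD ler_expR rmorphB /= -/a -/b.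
  have key : (M%:R ^+ 2 + b ^+ 2 + a ^+ 2) / 12 <= 3 * (b - a) ^+ 2 / 4 + J%:~R ^+ 2 / 48.
    by have := sqr_ge0 (b - a); lra.
  by have := ler_wpM2l (ltW y0) key; lra.
have inv12 (t : R) : 0 <= t -> (1 + y / 12 * t)^-1 <= 12 / y * (1 + t)^-1.
  move=> t0; rewrite (_ : 12 / y * _ = (y / 12 * (1 + t))^-1); last by rewrite invfM invf_div.
  have p : 0 < y / 12 by rewrite divr_gt0.
  have pt : 0 <= y / 12 * t by rewrite mulr_ge0 // ltW.
  rewrite lef_pV2 ?posrE; [lra|lra|].
  by rewrite mulr_gt0 //; lra.
have e1 : expR (- (y / 12 * M%:R ^+ 2)) <= 12 / (y * M%:R ^+ 2).
  have p : 0 < y / 12 * M%:R ^+ 2 by rewrite mulr_gt0 ?exprn_gt0 ?divr_gt0.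
  apply: le_trans (decay _ _ _ _) _; rewrite ?divr_ge0 ?sqr_ge0 ?(ltW y0) //.
  rewrite (_ : 12 / _ = (y / 12 * M%:R ^+ 2)^-1); last by field; rewrite !gt_eqF.
  by rewrite lef_pV2 ?posrE //; lra.
have e2 (t : R) : 0 <= t -> expR (- (y / 12 * t)) <= 12 / y * (1 + t)^-1.
  move=> t0; apply: le_trans (inv12 _ t0); apply: decay => //.
  by rewrite divr_ge0 // ltW.
rewrite (_ : 12 ^+ 3 / _ * _ = 12 / (y * M%:R ^+ 2) * ((12 / y * (1 + b ^+ 2)^-1) * (12 / y * (1 + a ^+ 2)^-1))); last first.
  by field; rewrite !gt_eqF // ltr_pwDl.
apply: ler_pM; rewrite ?mulr_ge0 ?expR_ge0 //.
by apply: ler_pM; rewrite ?expR_ge0 // e2.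
Qed.

(* Off the box [|k|, |k1| <= M] the binomial weights decay uniformly in [N], so the complete
   sum controlled by [smooth_sum_bound] differs from the box sum by [O(y^-3 M^-2)]. *)
Lemma box_sum_bound M (N : nat) x y : 0 < y <= 1 -> (0 < N)%N -> (0 < M)%N ->
  \sum_(k <- int_ball M) \sum_(k1 <- int_ball M)
    smooth_term (binomial_weight y N) x y (k1 - k) k <=
  2 * 72 ^+ 2 / Num.sqrt y + 360 ^+ 2 / (y ^+ 3 * M%:R ^+ 2).
Proof.
move=> y01 N0 M0; have /andP[y0 y1] := y01.
(* [H = 2 M] contains all differences [k1 - k] from the box; [W] meets the requirement of
   [smooth_sum_bound] and contains the box. *)
set m := gauss_index y N; set H := M.*2; pose W := (m + H + 1 + M)%N.
pose t h k := smooth_term (binomial_weight y N) x y h k.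
pose P (h k : int) := (`|k| <= M)%N && (`|(h + k)%R| <= M)%N.
have /andP[m1 m2] := gauss_index_bounds N y0; rewrite -/m in m1 m2.
have full : \sum_(k <- int_ball W) \sum_(h <- int_ball H) t h k <= 2 * 72 ^+ 2 / Num.sqrt y.
  rewrite exchange_big /=; apply: le_trans (ler_norm _) _.
  have N1 : 1 <= (N%:R : R) by rewrite ler1n.
  apply: (@smooth_sum_bound R x y N m H W) => //.
  - by rewrite /W leq_addr.
  - exact: ltW.
  - by apply: le_trans m2 _; nra.
have boxE : \sum_(k <- int_ball M) \sum_(k1 <- int_ball M) t (k1 - k) k =
    \sum_(k <- int_ball W) \sum_(h <- int_ball H | P h k) t h k.
  transitivity (\sum_(k <- [seq k <- int_ball W | (`|k| <= M)%N]) \sum_(k1 <- int_ball M) t (k1 - k) k).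
    apply: big_uniq_eq_mem; rewrite ?filter_uniq ?uniq_int_ball // => k.
    by rewrite mem_filter !mem_int_ball /W; lia.
  rewrite big_filter big_mkcond; apply: eq_bigr => k _; rewrite /P.
  case: ifP => kM; last by rewrite big_pred0.
  rewrite -[RHS]big_filter [RHS](@big_uniq_eq_mem _ _ _ [seq k1 - k | k1 <- int_ball M]) ?big_map //.
  - by rewrite filter_uniq ?uniq_int_ball.
  - by rewrite map_inj_uniq ?uniq_int_ball // => i j /addIr.
  move=> h; rewrite mem_filter andTb mem_int_ball; apply/andP/mapP => [[hk hH]|[k1]].
    by exists (h + k); rewrite ?mem_int_ball ?addrK.
  by rewrite mem_int_ball /H => k1M ->; rewrite subrK; split => //; lia.
rewrite boxE.
have split k : \sum_(h <- int_ball H) t h k =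
    \sum_(h <- int_ball H | P h k) t h k + \sum_(h <- int_ball H | ~~ P h k) t h k.
  by rewrite (bigID (fun h => P h k)).
have tail : - \sum_(k <- int_ball W) \sum_(h <- int_ball H | ~~ P h k) t h k <=
    360 ^+ 2 / (y ^+ 3 * M%:R ^+ 2).
  apply: le_trans (ler_norm _) _; rewrite normrN.
  set C := 12 ^+ 3 / (y ^+ 3 * M%:R ^+ 2).
  have C0 : 0 <= C.
    by rewrite divr_ge0 ?exprn_ge0 // mulr_ge0 ?sqr_ge0 // exprn_ge0 // ltW.
  have pos (z : R) : 0 <= (1 + z ^+ 2)^-1 by rewrite invr_ge0 addr_ge0 ?sqr_ge0.
  apply: le_trans (_ : _ <= \sum_(k <- int_ball W) C * 15 * (1 + k%:~R ^+ 2)^-1) _; last first.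
    rewrite -mulr_sumr; apply: le_trans (ler_wpM2l _ (sum_invsqr_int R (uniq_int_ball W))) _.
      by rewrite mulr_ge0.
    rewrite le_eqVlt; apply/orP; left; apply/eqP; rewrite /C.
    have -> : 360 ^+ 2 = 12 ^+ 3 * 15 * 5 :> R by ring.
    by move: (12 ^+ 3) => z; ring.
  apply: le_trans (ler_norm_sum _ _ _) _; apply: ler_sum => k _.
  apply: le_trans (_ : _ <= \sum_(h <- int_ball H) C * (1 + k%:~R ^+ 2)^-1 * (1 + (k%:~R + h%:~R) ^+ 2)^-1) _; last first.
    rewrite -mulr_sumr [leRHS]mulrAC.
    by apply: ler_wpM2l; [exact: mulr_ge0|exact/sum_invsqr_shift/uniq_int_ball].
  apply: le_trans (ler_norm_sum _ _ _) _; rewrite big_mkcond; apply: ler_sum => h _.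
  case: ifP => [out|_]; last by apply: mulr_ge0 => //; exact: mulr_ge0.
  have := @gauss_box_decay y N M k (h + k) y01 N0 M0 out; rewrite -/C.
  rewrite (_ : h + k - k = h) ?addrK // (_ : h + k + k = h + 2 * k); last by ring.
  rewrite [in (h + k)%:~R]addrC rmorphD /= => dec.
  apply: le_trans (le_trans _ dec) _; last by rewrite [in leRHS]mulrAC mulrA.
  have w0 : 0 <= binomial_weight y N (3 * (h + 2 * k) + 1) by rewrite divr_ge0.
  rewrite /t /smooth_term; move: (binomial_weight y N _) w0 => w w0.
  rewrite !normrM normrX normrN1 expr1n mul1r (ger0_norm (expR_ge0 _)) (ger0_norm w0).
  by rewrite ler_piMr ?cos_max // mulr_ge0 ?expR_ge0.
move: full; under eq_bigr do rewrite split.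
by rewrite big_split /= => full; lra.
Qed.

(** For fixed [M] the box sum is finite, so [N] can tend to infinity term by term in
    [box_sum_bound]. *)
Lemma theta_partial_bound M x y phi : 0 < y <= 1 -> (0 < M)%N ->
  theta_partial M x y phi ^+ 2 <=
  expR 1 * (2 * 72 ^+ 2 / Num.sqrt y + 360 ^+ 2 / (y ^+ 3 * M%:R ^+ 2)).
Proof.
move=> y01 M0; have /andP[y0 y1] := y01.
apply: le_trans (theta_partial_sqr M x y phi) _.
have le_box : \sum_(k <- int_ball M) \sum_(k1 <- int_ball M)
    smooth_term (fun J => expR (- (y * J%:~R ^+ 2 / 12))) x y (k1 - k) k <=
    2 * 72 ^+ 2 / Num.sqrt y + 360 ^+ 2 / (y ^+ 3 * M%:R ^+ 2).
  pose B := 2 * 72 ^+ 2 / Num.sqrt y + 360 ^+ 2 / (y ^+ 3 * M%:R ^+ 2).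
  apply: (@ler_cvg_to _ \oo _ _ (fun n => \sum_(k <- int_ball M) \sum_(k1 <- int_ball M)
    smooth_term (binomial_weight y n.+1) x y (k1 - k) k) (fun=> B)).
  - apply: cvg_big; first exact: add_continuous.
    move=> k _; apply: cvg_big; first exact: add_continuous.
    move=> k1 _; rewrite /smooth_term; apply: cvgM; last exact: cvg_cst.
    by apply: cvgM; [exact: cvg_cst|exact: binomial_weight_cvg].
  - exact: cvg_cst.
  - by apply: nearW => n; exact: box_sum_bound.
apply: ler_pM; rewrite ?expR_ge0 //; last by rewrite ler_expR; lra.
have := theta_partial_sqr M x y phi; move: (\sum_(k <- _) _) => S h.
have : 0 <= expR (y / 12) * S by apply: le_trans h; exact: sqr_ge0.
by rewrite pmulr_rge0 ?expR_gt0.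
Qed.

End ThetaBound.

(** * The fractional integral *)

Section EulerSeries.
Variable R : realType.
Implicit Types (s p x y phi r : R) (M : nat).

(** Stopping at [pent_pos M] makes the sum correspond exactly to the theta terms with
    [1 <= |k| <= M]. *)
Definition euler_trig M (w : nat -> R) x phi : R :=
  \sum_(1 <= n < (pent_pos M).+1) (euler_coef n)%:~R * (cos (2 * pi * n%:R * x + phi) * w n).

Lemma pent_realE (j : nat) :
  pent_real R (- j%:Z) = (pent_neg j)%:R /\ pent_real R j%:Z = (pent_pos j)%:R.
Proof.
have e : (2 * 'C(j, 2)%:R : R) = j%:R * (j%:R - 1).
  case: j => [|j]; first by rewrite mulr0 mul0r.
  by have := mul_bin_diag j.+1 1; rewrite bin1 => h; rewrite -natrM -h natrM -[j.+1%:R]natr1 addrK.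
rewrite /pent_real pent_pos_neg /pent_neg !natrD natrM.
rewrite !(rmorphM, rmorphD, rmorphN) /= -!pmulrn rmorph1.
by split; apply: (mulIf (_ : 2 != 0 :> R)) => //; rewrite mulfVK // !mulrDl [_%:R * 2]mulrC e; ring.
Qed.

Lemma euler_trig_theta M x y phi :
  euler_trig M (fun n => expR (- (y * n%:R))) x phi = theta_partial M x y phi - cos phi.
Proof.
rewrite /euler_trig (euler_sum (fun n => cos (2 * pi * n%:R * x + phi) * expR (- (y * n%:R)))).
have p0 : pent_real R 0 = 0 by rewrite /pent_real !mul0r.
rewrite /theta_partial big_int_ball p0 absz0 expr0 !mulr0 mul0r add0r oppr0 expR0 !mul1r.
rewrite [RHS]addrC addKr; apply: eq_bigr => j _; have [e1 e2] := pent_realE j.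
by rewrite e1 e2 abszN absz_nat; ring.
Qed.

Lemma euler_trig_decay M x y phi : 0 < y ->
  `|euler_trig M (fun n => expR (- (y * n%:R))) x phi| <= 2 / y.
Proof.
move=> y0; rewrite /euler_trig (euler_sum (fun n => cos (2 * pi * n%:R * x + phi) * expR (- (y * n%:R)))).
pose q := expR (- y).
have q0 : 0 < q by exact: expR_gt0.
have term (j g : nat) : (j <= g)%N -> `|cos (2 * pi * g%:R * x + phi) * expR (- (y * g%:R))| <= q ^+ j.
  move=> jg; rewrite normrM (ger0_norm (expR_ge0 _)).
  apply: le_trans (_ : _ <= 1 * expR (- (y * g%:R))) _; first by rewrite ler_wpM2r ?expR_ge0 ?cos_max.
  by rewrite mul1r /q -expRM_natl ler_expR mulrC mulrN lerN2 ler_wpM2r ?ler_nat // ltW.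
apply: le_trans (ler_norm_sum _ _ _) _.
apply: le_trans (_ : _ <= \sum_(1 <= j < M.+1) 2 * q ^+ j) _.
  apply: ler_sum => j _; rewrite normrM normrX normrN1 expr1n mul1r.
  apply: le_trans (ler_normD _ _) _; rewrite [leRHS](_ : _ = q ^+ j + q ^+ j); last by ring.
  by apply: lerD; apply: term; rewrite ?pent_pos_neg ?pent_neg_ge ?leq_addl.
rewrite -mulr_sumr ler_wpM2l //.
have geo : (\sum_(1 <= j < M.+1) q ^+ j) * (1 - q) = q - q ^+ M.+1.
  elim: M => [|M IHM]; first by rewrite big_geq // mul0r expr1 subrr.
  by rewrite big_nat_recr //= mulrDl IHM !exprS; ring.
have qy : q * (1 + y) <= 1.
  by rewrite /q expRN ler_pdivrMl ?expR_gt0 // mulr1 expR_ge1Dx.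
have qM : 0 < q ^+ M.+1 by exact: exprn_gt0.
have q1 : 0 < 1 - q by nra.
rewrite -[leRHS]mul1r ler_pdivlMr // -(ler_pM2r q1) mulrAC geo; nra.
Qed.

(** The condition on [M] makes the truncation error at most 1, and [y <= 1] gives [y^(-1/4) >= 1],
    which absorbs this error and the missing term [n = 0]. *)
Lemma euler_trig_cusp : exists2 C : R, 0 <= C & forall M x y phi,
  0 < y <= 1 -> (0 < M)%N -> 360 ^+ 2 <= y ^+ 3 * M%:R ^+ 2 ->
  `|euler_trig M (fun n => expR (- (y * n%:R))) x phi| <= C * y `^ (- (1 / 4)).
Proof.
pose D : R := expR 1 * (2 * 72 ^+ 2 + 1).
have D0 : 0 <= D by rewrite mulr_ge0 ?expR_ge0 // addr_ge0 // mulr_ge0 // exprn_ge0.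
exists (Num.sqrt D + 1) => [|M x y phi y01 M0 yM]; first by rewrite addr_ge0 ?sqrtr_ge0.
have /andP[y0 y1] := y01.
pose z := y `^ (- (1 / 4)).
have z1 : 1 <= z.
  have q4 : - (1 / 4) <= 0 :> R by lra.
  by have := ger_powR y01 q4; rewrite powRr0.
have z2 : z ^+ 2 = (Num.sqrt y)^-1.
  rewrite -powR12_sqrt ?(ltW y0) // -powRN -powR_mulrn ?powR_ge0 // -powRrM.
  by congr (_ `^ _); lra.
rewrite euler_trig_theta -/z mulrDl mul1r.
apply: le_trans (ler_normB _ _) _; apply: lerD; last exact: le_trans (cos_max _) z1.
rewrite -ler_sqr ?nnegrE ?mulr_ge0 ?sqrtr_ge0 ?powR_ge0 // real_normK ?num_real //.
apply: le_trans (theta_partial_bound x phi y01 M0) _.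
rewrite [leRHS]exprMn (sqr_sqrtr D0) z2 /D -[leRHS]mulrA ler_wpM2l ?expR_ge0 // [leRHS]mulrDl lerD2l mul1r -z2.
apply: le_trans (_ : _ <= 1) _; last by rewrite expr_ge1 // (le_trans _ z1).
by rewrite ler_pdivrMr ?mul1r // mulr_gt0 // exprn_gt0 // ltr0n.
Qed.

(** [G] is the integral of [exp (- r^p)] over [r > 0], obtained as the supremum of the increments of
    a primitive. These are bounded because the integrand is at most 1, and at most [r^(-p)] for
    [r >= 1]. *)
Lemma gamma_primitive p : 1 < p -> exists V : R -> R, exists2 G : R, 0 < G &
  [/\ forall r, 0 < r -> is_derive r 1 V (expR (- (r `^ p))),
      forall a b, 0 < a <= b -> 0 <= V b - V a <= G
    & forall e, 0 < e -> exists a0 b0, [/\ 0 < a0, 0 < b0 &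
        forall a b, 0 < a <= a0 -> b0 <= b -> G - e <= V b - V a]].
Proof.
move=> p1; pose f r : R := expR (- (r `^ p)).
have f1 r : f r <= 1 by rewrite /f expR_le1 oppr_le0 powR_ge0.
have f0 r : 0 <= f r by exact: expR_ge0.
have [V dV] : exists V : R -> R, forall r, 0 < r -> is_derive r 1 V (f r).
  exists (fun x => \int[lebesgue_measure]_(t in `[0, x]) f t)%R => r r0.
  have mf : measurable_fun setT f.
    have mg : measurable_fun setT (fun t : R => expR (- t)).
      apply: continuous_measurable_fun => t; apply: continuous_comp; first exact: opp_continuous.
      exact: continuous_expR.
    exact: (measurableT_comp mg (measurable_powR p)).
  have fi : lebesgue_measure.-integrable `[0, r + 1] (EFin \o f).
    apply: measurable_bounded_integrable => //.
    - by rewrite /= lebesgue_measure_itv /= lte_fin; case: ifP; rewrite ?ltry.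
    - exact: measurable_funTS.
    - exists 1; split; first exact: num_real.
      by move=> z z1 t _ /=; rewrite ger0_norm // (le_trans (f1 t)) // ltW.
  have cf : {for r, continuous f}.
    have d : is_derive r 1 f (f r * - (p * r `^ (p - 1))).
      have dp := is_derive1_powR p r0.
      have -> : f = expR \o (fun t => - (t `^ p)) by [].
      exact: is_derive1_comp.
    by apply: differentiable_continuous; apply/derivable1_diffP; exact: ex_derive.
  have [d1 d2] := continuous_FTC1_closed (ltr_pwDr ltr01 (lexx r)) fi r0 cf.
  by split; [exact: d1|rewrite -derive1E; exact: d2].
have mono a b : 0 < a <= b -> V a <= V b.
  move=> /andP[a0 ab]; apply: (@ndecr_is_derive R V f) => // x /andP[ax xb].
  by apply: dV; apply: lt_le_trans ax.
have near0 a b : 0 < a <= b -> V b - V a <= b - a.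
  move=> /andP[a0 ab].
  have := @ndecr_is_derive R (fun r => r - V r) (fun r => 1 - f r) a b ab.
  suff h : (forall r, a <= r <= b -> is_derive r 1 (fun r => r - V r) (1 - f r)).
    have pos r : a <= r <= b -> 0 <= 1 - f r by rewrite subr_ge0.
    by move=> /(_ h pos); lra.
  by move=> r /andP[ar _]; have d := dV r (lt_le_trans a0 ar); exact: is_deriveB.
have far b : 1 <= b -> V b - V 1 <= 1 / (p - 1).
  move=> b1; pose h r := - (r `^ (1 - p)) / (p - 1) - V r.
  have dh r : 1 <= r <= b -> is_derive r 1 h (r `^ (- p) - f r).
    move=> /andP[r1 _]; have r0 : 0 < r by lra.
    have d1 := is_derive1_powR (1 - p) r0; have d2 := dV r r0.
    apply: is_derive_eq; rewrite /GRing.scale /=.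
    rewrite (_ : 1 - p - 1 = - p); last by ring.
    by field; rewrite gt_eqF // subr_gt0.
  have := @ndecr_is_derive R h (fun r => r `^ (- p) - f r) 1 b b1 dh.
  have pos r : 1 <= r <= b -> 0 <= r `^ (- p) - f r.
    move=> /andP[r1 _]; have r0 : 0 < r by lra.
    rewrite subr_ge0 /f expRN powRN lef_pV2 ?posrE ?expR_gt0 ?powR_gt0 //.
    by apply: le_trans (expR_ge1Dx _); lra.
  move=> /(_ pos); rewrite /h powR1.
  have : 0 <= b `^ (1 - p) / (p - 1) by rewrite divr_ge0 ?powR_ge0 // subr_ge0 ltW.
  lra.
pose E := [set d : R | exists a b, 0 < a <= b /\ d = V b - V a].
have Eub : has_ubound E.
  exists (1 + 1 / (p - 1)) => _ [a [b [/andP[a0 ab] ->]]].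
  have pp : 0 < 1 / (p - 1) by rewrite divr_gt0 // subr_gt0.
  have [b1|b1] := leP b 1; first by have := @near0 a b; rewrite a0 ab => /(_ isT); lra.
  have Vb := far b (ltW b1).
  have [a1|a1] := leP a 1; first by have := @near0 a 1; rewrite a0 a1 => /(_ isT); lra.
  have := @mono 1 a; rewrite ltr01 (ltW a1) => /(_ isT); lra.
have E0 : has_sup E by split => //; exists (V 1 - V 1), 1, 1; rewrite ltr01 lexx.
have supE a b : 0 < a <= b -> V b - V a <= sup E.
  by move=> ab; apply: ub_le_sup => //; exists a, b.
exists V; exists (sup E); last split.
(* Positivity of [G]: on [[1, 2]] the integrand is at least [exp (- 2^p)]. *)
- have h := supE 1 2; apply: lt_le_trans (h _); last by lra.
  rewrite subr_gt0; have := @ndecr_is_derive R (fun r => V r - expR (- (2 `^ p)) * r) (fun r => f r - expR (- (2 `^ p))) 1 2.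
  have d r : 1 <= r <= 2 -> is_derive r 1 (fun r => V r - expR (- (2 `^ p)) * r) (f r - expR (- (2 `^ p))).
    move=> /andP[r1 _]; have d := dV r (lt_le_trans ltr01 r1).
    by apply: is_derive_eq; rewrite /GRing.scale /= mulr1.
  move=> /(_ _ d) k; have := expR_gt0 (- (2 `^ p) : R).
  suff : V 1 - expR (- (2 `^ p)) * 1 <= V 2 - expR (- (2 `^ p)) * 2 by lra.
  apply: k; first by lra.
  move=> r /andP[r1 r2]; rewrite subr_ge0 ler_expR lerN2 ge0_ler_powR ?nnegrE //; lra.
- exact: dV.
- by move=> a b ab; rewrite supE // andbT subr_ge0 mono.
- move=> e e0; have [_ [a0 [b0 [/andP[a00 ab] ->]]] lt] := sup_adherent e0 E0.
  exists a0, b0; split=> //; first exact: lt_le_trans ab.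
  move=> a b /andP[ap aa] bb; have := @mono a a0; rewrite ap aa => /(_ isT).
  have := @mono b0 b; rewrite bb (lt_le_trans a00 ab) => /(_ isT); lra.
Qed.

Lemma mean_value_bound (f f' g g' : R -> R) a b : a <= b ->
  (forall r, a <= r <= b -> is_derive r 1 f (f' r)) ->
  (forall r, a <= r <= b -> is_derive r 1 g (g' r)) ->
  (forall r, a <= r <= b -> `|f' r| <= g' r) -> `|f b - f a| <= g b - g a.
Proof.
move=> ab df dg fg; rewrite ler_norml.
have h1 := @ndecr_is_derive R (fun r => g r - f r) (fun r => g' r - f' r) a b ab.
have h2 := @ndecr_is_derive R (fun r => g r + f r) (fun r => g' r + f' r) a b ab.
have d1 r : a <= r <= b -> is_derive r 1 (fun r => g r - f r) (g' r - f' r).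
  by move=> rab; have := df r rab; have := dg r rab => ? ?; exact: is_deriveB.
have d2 r : a <= r <= b -> is_derive r 1 (fun r => g r + f r) (g' r + f' r).
  by move=> rab; have := df r rab; have := dg r rab => ? ?; exact: is_deriveD.
have p1 r : a <= r <= b -> 0 <= g' r - f' r.
  by move=> /fg; rewrite ler_norml => /andP[]; lra.
have p2 r : a <= r <= b -> 0 <= g' r + f' r.
  by move=> /fg; rewrite ler_norml => /andP[]; lra.
by have := h1 d1 p1; have := h2 d2 p2; lra.
Qed.

Lemma is_derive_bigsum (I : eqType) (t : seq I) (h : I -> R -> R) (dh : I -> R) r :
  (forall i, i \in t -> is_derive r 1 (h i) (dh i)) ->
  is_derive r 1 (fun x => \sum_(i <- t) h i x) (\sum_(i <- t) dh i).
Proof.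
elim: t => [|i t IHt] dt.
  rewrite big_nil (_ : (fun x => _) = cst 0); first exact: is_derive_cst.
  by apply/funext => x; rewrite big_nil.
rewrite big_cons (_ : (fun x => _) = h i + (fun x => \sum_(i <- t) h i x)); last first.
  by apply/funext => x; rewrite big_cons.
have d1 := dt i (mem_head _ _).
have d2 : is_derive r 1 (fun x => \sum_(i <- t) h i x) (\sum_(i <- t) dh i).
  by apply: IHt => j jt; apply: dt; rewrite inE jt orbT.
exact: is_deriveD.
Qed.

(* [G n^-s] is the integral of [exp (- n r^(1/s))] over [r > 0]; cutting it off to [a < r < b]
   multiplies the [n]-th coefficient by [v n], and the cut-off integral is estimated with the
   bound [y^(-1/4)] at [y = r^(1/s)], which is integrable at [0] precisely when [s > 1/4]. *)
Lemma smoothed_series_bound s : 1 / 4 < s < 1 / 2 -> exists2 B : R, 0 <= B &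
  forall e (N0 : nat), 0 < e -> exists v : nat -> R, exists M0 : nat,
  [/\ forall n, (0 < n)%N -> 0 <= v n <= 1,
      forall n, (0 < n <= N0)%N -> 1 - e <= v n
    & forall M x phi, (M0 <= M)%N -> `|euler_trig M (fun n => v n / n%:R `^ s) x phi| <= B].
Proof.
move=> /andP[s4 s2]; pose p := s^-1; have s0 : 0 < s by lra.
have sp : s * p = 1 by rewrite mulfV // gt_eqF.
have p2 : 2 < p by nra.
have p4 : p < 4 by nra.
have p1 : 1 < p by lra.
have [V [G G0 [dV bV lV]]] := gamma_primitive p1.
have [C C0 cusp] := euler_trig_cusp.
have q0 : 0 < 1 - p / 4 by lra.
have q1 : 0 < p - 1 by lra.
exists ((C / (1 - p / 4) + 2 / (p - 1)) / G).
  by rewrite divr_ge0 ?addr_ge0 ?divr_ge0 // ltW.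
move=> e N0 e0; have [a0 [b0 [a00 b00 lV']]] := lV (e * G) (mulr_gt0 e0 G0).
have pos (n : nat) : (0 < n)%N -> 0 < n%:R `^ s :> R by move=> n0; rewrite powR_gt0 // ltr0n.
(* [a] is so small that [n^s a <= a0] for all [n <= N0], and [b >= b0], so the cut-off loses at most
   [e G] for these [n]. *)
pose a := Num.min 1 (a0 / N0.+1%:R `^ s); pose b := Num.max 1 b0.
have ap : 0 < a by rewrite lt_min ltr01 divr_gt0 // pos.
have a1 : a <= 1 by rewrite ge_min lexx.
have b1 : 1 <= b by rewrite le_max lexx.
have ab : a <= b by apply: le_trans b1.
pose v (n : nat) := (V (n%:R `^ s * b) - V (n%:R `^ s * a)) / G.
pose y0 := a `^ p; have y00 : 0 < y0 by rewrite powR_gt0.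
(* [M0] makes the cusp bound available for every [y >= y0 = a^p]. *)
exists v, (Num.truncn (360 ^+ 2 / y0 ^+ 3)).+1; split.
- move=> n n0; have := bV (n%:R `^ s * a) (n%:R `^ s * b).
  rewrite mulr_gt0 ?pos // ler_wpM2l ?powR_ge0 // => /(_ isT) /andP[h1 h2].
  by rewrite divr_ge0 ?(ltW G0) // ler_pdivrMr // mul1r.
- move=> n /andP[n0 nN]; rewrite ler_pdivlMr // mulrBl mul1r; apply: lV'.
    rewrite mulr_gt0 ?pos //; apply: le_trans (_ : _ <= n%:R `^ s * (a0 / N0.+1%:R `^ s)) _.
      by rewrite ler_wpM2l ?powR_ge0 // ge_min lexx orbT.
    rewrite mulrA ler_pdivrMr ?pos // mulrC ler_wpM2l ?(ltW a00) //.
    by rewrite ge0_ler_powR ?nnegrE ?(ltW s0) // ler_nat ltnW.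
  apply: le_trans (_ : _ <= 1 * b) _; first by rewrite mul1r le_max lexx orbT.
  have n1 : 1 <= n%:R :> R by rewrite ler1n.
  rewrite ler_wpM2r ?(le_trans ler01) //.
  by have := ler_powR n1 (ltW s0); rewrite powRr0.
move=> M x phi MM.
(* By the substitution [r -> n^s r], the derivative of [K] is the trigonometric sum with weights
   [exp (- n r^p)]. *)
pose K r := \sum_(n <- index_iota 1 (pent_pos M).+1)
  (euler_coef n)%:~R * (cos (2 * pi * n%:R * x + phi) * (V (n%:R `^ s * r) / n%:R `^ s)).
have dK r : 0 < r -> is_derive r 1 K (euler_trig M (fun n => expR (- (r `^ p * n%:R))) x phi).
  move=> r0; apply: is_derive_bigsum => n; rewrite mem_index_iota => /andP[n0 _].
  have np := pos n n0.
  have dn : is_derive (n%:R `^ s * r) 1 V (expR (- (r `^ p * n%:R))).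
    have -> : r `^ p * n%:R = (n%:R `^ s * r) `^ p.
      by rewrite powRM ?powR_ge0 ?(ltW r0) // -powRrM sp powRr1 // mulrC.
    by apply: dV; rewrite mulr_gt0.
  have dl : is_derive r 1 (fun r : R => n%:R `^ s * r) (n%:R `^ s).
    by apply: is_derive_eq; rewrite /GRing.scale /= mulr1.
  have dc := is_derive1_comp dn dl.
  rewrite [X in is_derive r 1 X _](_ : _ =
    (fun r => ((euler_coef n)%:~R * cos (2 * pi * n%:R * x + phi) / n%:R `^ s) * (V \o (fun r => n%:R `^ s * r)) r)); last first.
    by apply/funext => z /=; ring.
  apply: is_derive_eq; rewrite /GRing.scale /=; move: np; set w := n%:R `^ s => np.
  by move: (expR _) (cos _) => E c; clearbody w; field; rewrite gt_eqF.
have -> : euler_trig M (fun n => v n / n%:R `^ s) x phi = (K b - K a) / G.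
  rewrite /euler_trig /K -sumrB mulr_suml; apply: eq_bigr => n _; rewrite /v; ring.
rewrite normrM normfV (gtr0_norm G0) ler_wpM2r ?invr_ge0 ?(ltW G0) //.
rewrite (_ : K b - K a = (K 1 - K a) + (K b - K 1)); last by ring.
apply: le_trans (ler_normD _ _) _; apply: lerD.
(* On [[a, 1]] the cusp bound gives [C r^(-p/4)], with integral at most [C / (1 - p / 4)] since
   [p < 4]. *)
- pose g r := C * (r `^ (1 - p / 4) / (1 - p / 4)).
  have dg r : a <= r <= 1 -> is_derive r 1 g (C * r `^ (- (p / 4))).
    move=> /andP[ar _]; have d := is_derive1_powR (1 - p / 4) (lt_le_trans ap ar).
    apply: is_derive_eq; rewrite /GRing.scale /=.
    rewrite (_ : 1 - p / 4 - 1 = - (p / 4)); last by ring.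
    by rewrite mulr0 add0r mulKf // gt_eqF.
  apply: le_trans (_ : _ <= g 1 - g a) _; last first.
    by rewrite /g powR1 mul1r gerBl mulr_ge0 // divr_ge0 ?powR_ge0 // ltW.
  apply: mean_value_bound dg _ => // r /andP[ar r1]; first by apply: dK; exact: lt_le_trans ar.
  have r0 := lt_le_trans ap ar.
  rewrite (_ : - (p / 4) = p * - (1 / 4)); last by ring.
  rewrite powRrM; apply: cusp.
  + have p0 : 0 <= p by lra.
    have := @ge0_ler_powR R p p0 r 1; rewrite !nnegrE (ltW r0) ler01 powR1 => h.
    by rewrite powR_gt0 //= h.
  + exact: leq_trans MM.
  have yr : y0 <= r `^ p by rewrite ge0_ler_powR ?nnegrE ?(ltW ap) ?(ltW r0) //; lra.
  have M1 : 360 ^+ 2 / y0 ^+ 3 <= M%:R ^+ 2.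
    have h := truncnS_gt (360 ^+ 2 / y0 ^+ 3).
    have {}h : 360 ^+ 2 / y0 ^+ 3 <= M%:R by apply: (le_trans (ltW h)); rewrite ler_nat.
    apply: le_trans h _; by rewrite -natrX ler_nat expnS expn1 leq_pmulr // (leq_trans _ MM).
  rewrite ler_pdivrMr ?exprn_gt0 // in M1; apply: le_trans M1 _.
  by rewrite mulrC ler_wpM2r ?sqr_ge0 // lerXn2r ?nnegrE ?powR_ge0.
(* On [[1, b]] the decay bound gives [2 r^(-p)], with integral at most [2 / (p - 1)]. *)
- pose g r := - (2 * (r `^ (1 - p) / (p - 1))).
  have dg r : 1 <= r <= b -> is_derive r 1 g (2 * r `^ (- p)).
    move=> /andP[r1 _]; have d := is_derive1_powR (1 - p) (lt_le_trans ltr01 r1).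
    apply: is_derive_eq; rewrite /GRing.scale /=.
    rewrite (_ : 1 - p - 1 = - p); last by ring.
    by rewrite mulr0 add0r -(opprB p 1) mulNr mulrN mulKf ?mulrN ?opprK // gt_eqF.
  apply: le_trans (_ : _ <= g b - g 1) _; last first.
    by rewrite /g powR1 mul1r opprK addrC gerDl oppr_le0 mulr_ge0 // divr_ge0 ?powR_ge0 // ltW.
  apply: mean_value_bound dg _ => // r /andP[r1 rb]; first by apply: dK; exact: lt_le_trans r1.
  by rewrite powRN; apply: euler_trig_decay; rewrite powR_gt0 // (lt_le_trans ltr01 r1).
Qed.

End EulerSeries.

(** * Passage to the limit in L2 *)

Section SquareIntegral.
Variable R : realType.
Notation mu := (@lebesgue_measure R).
Notation D := (@unit_interval R).

Lemma unit_intervalE : D = `[0, 1]%classic.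
Proof. by apply/seteqP; split => x /=; rewrite /unit_interval /= in_itv. Qed.

Local Open Scope ereal_scope.

Lemma measurable_unit_interval : measurable D.
Proof. by rewrite unit_intervalE; exact: measurable_itv. Qed.

Lemma measure_unit_interval : mu D = 1.
Proof. by rewrite unit_intervalE lebesgue_measure_itv /= lte_fin ltr01 oppr0 adde0. Qed.

Lemma measurable_normr_gt (g : R -> R) (t : R) : measurable_fun D g ->
  measurable (D `&` [set x | (t < `|g x|)%R]).
Proof.
move=> mg; have mD := measurable_unit_interval.
have := measurableT_comp (@normr_measurable R setT) mg.
move=> /(_ mD `]t, +oo[%classic (measurable_itv _)); congr (measurable (_ `&` _)).
by apply/seteqP; split => x /=; rewrite in_itv /= andbT.
Qed.

Lemma sqr_chebyshev (g : R -> R) : measurable_fun D g ->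
  mu (D `&` [set x | (1 / 2 < `|g x|)%R]) <= 4%:E * \int[mu]_(x in D) ((g x ^+ 2)%R)%:E.
Proof.
move=> mg; have mD := measurable_unit_interval.
have mE := measurable_normr_gt (1 / 2) mg.
have m4 : measurable_fun D (fun x => (4 * g x ^+ 2)%:E).
  by apply/measurable_EFinP; apply: measurable_funM => //; exact: measurable_funX.
have -> : 4%:E * \int[mu]_(x in D) ((g x ^+ 2)%R)%:E = \int[mu]_(x in D) ((4 * g x ^+ 2)%R)%:E.
  rewrite -ge0_integralZl_EFin //.
  - by move=> x _; rewrite lee_fin sqr_ge0.
  - by apply/measurable_EFinP; exact: measurable_funX.
apply: (@le_trans _ _ (\int[mu]_(x in D `&` [set x | (1 / 2 < `|g x|)%R]) ((4 * g x ^+ 2)%R)%:E)); last first.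
  apply: ge0_subset_integral => //.
  by move=> x _; rewrite lee_fin mulr_ge0 // sqr_ge0.
rewrite -[leLHS]mul1e -integral_cst //; apply: ge0_le_integral => //.
- exact: measurable_funS m4.
- move=> x [_ /= gx]; rewrite lee_fin -(real_normK (num_real (g x))).
  have : (0 <= `|g x|)%R by []; nra.
Qed.

Lemma sqr_integral_triangle (f g h : R -> R) :
  measurable_fun D f -> measurable_fun D g -> measurable_fun D h ->
  \int[mu]_(x in D) (((g x - h x) ^+ 2)%R)%:E <=
  2%:E * \int[mu]_(x in D) (((f x - g x) ^+ 2)%R)%:E +
  2%:E * \int[mu]_(x in D) (((f x - h x) ^+ 2)%R)%:E.
Proof.
move=> mf mg mh; have mD := measurable_unit_interval.
have m (a b : R -> R) : measurable_fun D a -> measurable_fun D b ->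
    measurable_fun D (fun x => ((a x - b x) ^+ 2)%:E).
  by move=> ma mb; apply/measurable_EFinP; apply: measurable_funX; exact: measurable_funB.
have z (a b : R -> R) x : D x -> 0 <= ((a x - b x) ^+ 2)%:E by move=> _; rewrite lee_fin sqr_ge0.
have m2 (a b : R -> R) : measurable_fun D a -> measurable_fun D b ->
    measurable_fun D (fun x => 2%:E * ((a x - b x) ^+ 2)%:E).
  move=> ma mb; apply: (eq_measurable_fun (fun x => (2 * (a x - b x) ^+ 2)%:E)) => //.
  by apply/measurable_EFinP; apply: measurable_funM => //; apply: measurable_funX; exact: measurable_funB.
have z2 (a b : R -> R) x : D x -> 0 <= 2%:E * ((a x - b x) ^+ 2)%:E.
  by move=> Dx; apply: mule_ge0 => //; exact: z.
rewrite -!ge0_integralZl_EFin //; try by [exact: z|exact: m].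
rewrite -ge0_integralD //; try by [exact: z2|exact: m2].
apply: ge0_le_integral => //.
- by move=> x Dx; exact: z.
- exact: m.
- by apply: emeasurable_funD; exact: m2.
- move=> x _; rewrite -!EFinM -EFinD lee_fin.
  have := sqr_ge0 (f x - g x + (f x - h x))%R; nra.
Qed.

End SquareIntegral.

(** * Parseval's identity for cosine sums with a phase *)

Section Parseval.
Variable R : realType.
Notation mu := (@lebesgue_measure R).

Implicit Types (d : int) (x psi : R).

Definition cos_primitive d psi x : R :=
  if d == 0 then x * cos psi
  else sin (2 * pi * d%:~R * x + psi) / (2 * pi * d%:~R).

Lemma is_derive_cos_primitive d psi x :
  is_derive x 1 (cos_primitive d psi) (cos (2 * pi * d%:~R * x + psi)).
Proof.
rewrite /cos_primitive; have [->|d0] := eqVneq d 0.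
  rewrite mulr0z mulr0 mul0r add0r.
  by apply: is_derive_eq; rewrite /GRing.scale /=; ring.
have w0 : 2 * pi * d%:~R != 0 :> R by rewrite !mulf_neq0 ?intr_eq0 // gt_eqF // pi_gt0.
move: w0; set w := 2 * pi * d%:~R => w0.
rewrite (_ : (fun x0 => _) = (fun y => w^-1 * (@sin R \o (fun z => w * z + psi)) y)); last first.
  by apply/funext => y /=; rewrite mulrC.
have d1 : is_derive x 1 (fun z : R => w * z + psi) w.
  by apply: is_derive_eq; rewrite /GRing.scale /= mulr1 addr0.
have d2 := @is_derive1_comp R (@sin R) (fun z => w * z + psi) x _ _ (is_derive_sin _) d1.
by apply: is_derive_eq; rewrite /GRing.scale /=; field.
Qed.

Lemma cos_primitive_period d psi :
  cos_primitive d psi 1 - cos_primitive d psi 0 = (d == 0)%:R * cos psi.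
Proof.
rewrite /cos_primitive; case: eqVneq => [d0|d0]; first by rewrite mul0r subr0.
rewrite mulr0 add0r mul0r mulr1 [_ + psi]addrC.
have -> : sin (psi + 2 * pi * d%:~R) = sin psi.
  by rewrite -!cosBpihalf -[RHS](cosD2pik _ d); congr cos; ring.
by rewrite subrr.
Qed.

(** Products become cosines of frequencies [n - m] and [n + m]. Over a period only frequency 0
    survives, and [n + m > 0], so the phase drops out. *)
Lemma parseval_cos (b : nat -> R) (phi : R) (N : nat) :
  (\int[mu]_(x in @unit_interval R)
     (((\sum_(1 <= n < N.+1) b n * cos (2 * pi * n%:R * x + phi)) ^+ 2)%R)%:E =
   (1 / 2 * \sum_(1 <= n < N.+1) b n ^+ 2)%:E)%E.
Proof.
pose r := index_iota 1 N.+1.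
pose f x := (\sum_(n <- r) b n * cos (2 * pi * n%:R * x + phi)) ^+ 2.
pose F x := \sum_(n <- r) \sum_(m <- r) b n * b m / 2 *
  (cos_primitive (n%:Z - m%:Z) 0 x + cos_primitive (n%:Z + m%:Z) (2 * phi) x).
have dF (x : R) : is_derive x 1 F (f x).
  have -> : f x = \sum_(n <- r) \sum_(m <- r) b n * b m / 2 *
      (cos (2 * pi * (n%:Z - m%:Z)%:~R * x + 0) + cos (2 * pi * (n%:Z + m%:Z)%:~R * x + 2 * phi)).
    rewrite /f expr2 mulr_suml; apply: eq_bigr => n _; rewrite mulr_sumr; apply: eq_bigr => m _.
    have -> : 2 * pi * (n%:Z - m%:Z)%:~R * x + 0 =
        (2 * pi * n%:R * x + phi) - (2 * pi * m%:R * x + phi).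
      by rewrite rmorphB /= -!pmulrn; ring.
    have -> : 2 * pi * (n%:Z + m%:Z)%:~R * x + 2 * phi =
        (2 * pi * n%:R * x + phi) + (2 * pi * m%:R * x + phi).
      by rewrite rmorphD /= -!pmulrn; ring.
    by move: (_ + phi) (2 * pi * m%:R * x + phi) => A B; rewrite cosB cosD; field.
  apply: is_derive_bigsum => n _; apply: is_derive_bigsum => m _.
  have d1 := is_derive_cos_primitive (n%:Z - m%:Z) 0 x.
  have d2 := is_derive_cos_primitive (n%:Z + m%:Z) (2 * phi) x.
  by apply: is_derive_eq; rewrite /GRing.scale /=.
have cF : continuous F.
  move=> x; have d := dF x.
  by apply: differentiable_continuous; apply/derivable1_diffP; exact: ex_derive.
have cf : continuous f.
  move=> x; pose g (n : nat) z : R := b n * cos (2 * pi * n%:R * z + phi).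
  have dg (n : nat) : is_derive x 1 (g n) (b n * - (sin (2 * pi * n%:R * x + phi) * (2 * pi * n%:R))).
    have d1 : is_derive x 1 (fun z : R => 2 * pi * n%:R * z + phi) (2 * pi * n%:R).
      by apply: is_derive_eq; rewrite /GRing.scale /= mulr1 addr0.
    have d2 := @is_derive1_comp R (@cos R) (fun z => 2 * pi * n%:R * z + phi) x _ _ (is_derive_cos _) d1.
    by apply: is_derive_eq; rewrite /GRing.scale /= mulNr.
  have ds : is_derive x 1 (fun z => \sum_(n <- r) g n z) _ := is_derive_bigsum (fun n _ => dg n).
  have d : derivable f x 1 by rewrite /f; exact: ex_derive.
  by apply: differentiable_continuous; apply/derivable1_diffP.
rewrite unit_intervalE; transitivity (\int[mu]_(x in `[0%R, 1%R]) (f x)%:E)%E; first by [].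
rewrite (@continuous_FTC2 R f F) ?ltr01 //; first last.
- by move=> x _; rewrite derive1E; have d := dF x; exact: derive_val.
- split; first by move=> x _; have d := dF x; exact: ex_derive.
    exact: cvg_at_right_filter (cF 0).
  exact: cvg_at_left_filter (cF 1).
- exact: continuous_subspaceT.
rewrite -EFinB; congr (_%:E); rewrite /F -sumrB mulr_sumr big_seq [RHS]big_seq.
apply: eq_bigr => n nr; rewrite -sumrB (bigD1_seq n) ?iota_uniq //= big1 ?addr0.
  have -> : forall p q p' q' c : R, c * (p + q) - c * (p' + q') = c * ((p - p') + (q - q')) by move=> *; ring.
  rewrite !cos_primitive_period subrr eqxx cos0.
  have -> : (n%:Z + n%:Z == 0) = false by move: nr; rewrite mem_index_iota; lia.
  by rewrite /= mulr0n mul0r addr0 mulr1n; field.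
move=> m mn; have -> : forall p q p' q' c : R, c * (p + q) - c * (p' + q') = c * ((p - p') + (q - q')) by move=> *; ring.
rewrite !cos_primitive_period.
have -> : (n%:Z - m%:Z == 0) = false by lia.
have -> : (n%:Z + m%:Z == 0) = false by move: nr; rewrite mem_index_iota; lia.
by rewrite !mul0r addr0 mulr0.
Qed.

End Parseval.

(** * Essential boundedness of the limit *)

Section EssentialBound.
Variable R : realType.
Notation mu := (@lebesgue_measure R).
Notation D := (@unit_interval R).

Definition cos_partial (s phi : R) (N : nat) (x : R) : R :=
  \sum_(1 <= n < N.+1) (euler_coef n)%:~R / n%:R `^ s * cos (2 * pi * n%:R * x + phi).

Lemma measurable_cos_sum (b : nat -> R) (phi : R) (r : seq nat) (E : set R) :
  measurable_fun E (fun x => \sum_(n <- r) b n * cos (2 * pi * n%:R * x + phi)).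
Proof.
apply: measurable_funTS; apply: measurable_sum => n; apply: measurable_funM => //.
apply: continuous_measurable_fun => x; apply: continuous_comp; last exact: continuous_cos.
by apply: cvgD; [apply: cvgM; [exact: cvg_cst|exact: cvg_id]|exact: cvg_cst].
Qed.

(** A smoothed sum [P] bounded by [B] lies close in L2 to a partial sum, itself close to [u]. Where
    [|u| > B + 1] one of the two distances exceeds [1 / 2], and Chebyshev's inequality makes that
    set arbitrarily small. *)
Lemma ess_bounded (s phi : R) (u : R -> R) : 1 / 4 < s < 1 / 2 -> measurable_fun D u ->
  (fun N : nat => \int[mu]_(x in D) (((u x - cos_partial s phi N x) ^+ 2)%R)%:E)%E @ \oo --> 0%E ->
  exists2 B : R, 0 <= B & mu (D `&` [set x | B < `|u x|]) = 0%E.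
Proof.
move=> s42 mu_ cv; have [B B0 HB] := smoothed_series_bound s42.
exists (B + 1); first by rewrite addr_ge0.
have mD := @measurable_unit_interval R.
pose T (N1 N2 : nat) : R := \sum_(N1 <= n < N2) ((euler_coef n)%:~R / n%:R `^ s) ^+ 2.
have mS N : measurable_fun D (cos_partial s phi N) by exact: measurable_cos_sum.
have mabs := @measurable_normr_gt R.
suff small eta : 0 < eta -> (mu (D `&` [set x | (B + 1 < `|u x|)%R]) <= (22 * eta)%:E)%E.
  apply/eqP; rewrite eq_le measure_ge0 andbT; apply/lee_addgt0Pr => e e0.
  rewrite add0e; apply: le_trans (small (e / 22) _) _; first by rewrite divr_gt0.
  by rewrite lee_fin mulrC divfK.
move=> eta0.
have [N1 _ HN1] : \forall N \near \oo,
    (\int[mu]_(x in D) (((u x - cos_partial s phi N x) ^+ 2)%R)%:E <= eta%:E)%E.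
  have := cv; move=> /fine_cvgP[fin /cvgr0Pnorm_le/(_ eta eta0)]; apply: filterS2 fin => N fN.
  rewrite /= => h; rewrite -(fineK fN) lee_fin; exact: le_trans (ler_norm _) h.
(* Two partial sums within [eta] of [u] are within [4 eta] of each other, and Parseval's factor
   [1 / 2] turns this into [8 eta]. *)
have tailT N : (N1 <= N)%N -> T N1.+1 N.+1 <= 8 * eta.
  move=> NN; have := sqr_integral_triangle mu_ (mS N1) (mS N).
  have cat (F : nat -> R) : \sum_(1 <= n < N.+1) F n =
      \sum_(1 <= n < N1.+1) F n + \sum_(N1.+1 <= n < N.+1) F n by exact: big_cat_nat.
  pose c n := if (N1 < n)%N then (euler_coef n)%:~R / n%:R `^ s else 0 : R.
  have -> : (\int[mu]_(x in D) (((cos_partial s phi N1 x - cos_partial s phi N x) ^+ 2)%R)%:E =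
      \int[mu]_(x in D) (((\sum_(1 <= n < N.+1) c n * cos (2 * pi * n%:R * x + phi)) ^+ 2)%R)%:E)%E.
    apply: eq_integral => x _; congr (_%:E); rewrite -[LHS]sqrrN opprB; congr (_ ^+ 2).
    rewrite /cos_partial !cat [LHS]addrC addKr [X in _ = X + _]big_nat [X in _ = X + _]big1 ?add0r.
      by rewrite big_nat [RHS]big_nat; apply: eq_bigr => n /andP[n1 _]; rewrite /c n1.
    by move=> n /andP[_ n1]; rewrite /c ltnNge -ltnS n1 mul0r.
  rewrite parseval_cos => h.
  have : ((1 / 2 * \sum_(1 <= n < N.+1) c n ^+ 2)%:E <= (4 * eta)%:E)%E.
    apply: le_trans h _; rewrite (_ : 4 * eta = 2 * eta + 2 * eta); last by ring.
    rewrite -[leRHS]/(2%:E * eta%:E + 2%:E * eta%:E)%E.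
    by apply: leeD; apply: lee_wpmul2l => //; apply: HN1 => /=.
  rewrite lee_fin cat big_nat big1 ?add0r; last first.
    by move=> n /andP[_ n1]; rewrite /c ltnNge -ltnS n1 expr0n.
  rewrite (_ : \sum_(N1.+1 <= n < N.+1) c n ^+ 2 = T N1.+1 N.+1); first by lra.
  by rewrite /T big_nat [RHS]big_nat; apply: eq_bigr => n /andP[n1 _]; rewrite /c n1.
have Tge0 (a b : nat) : 0 <= T a b by apply: sumr_ge0 => n _; exact: sqr_ge0.
(* This [e] makes the smoothing error on the first [N1] coefficients at most [e T1 <= eta]. *)
pose T1 := T 1%N N1.+1; pose e := Num.min 1 (eta / (T1 + 1)).
have T10 : 0 < T1 + 1 by rewrite ltr_wpDl ?Tge0.
have e0 : 0 < e by rewrite lt_min ltr01 divr_gt0.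
have [v [M0 [v01 v1 vB]]] := HB e N1 e0.
pose M := maxn M0 N1; pose N := pent_pos M.
have N1N : (N1 <= N)%N.
  by rewrite /N pent_pos_neg (leq_trans _ (leq_addl _ _)) // leq_maxr.
pose P x := \sum_(1 <= n < N.+1) ((euler_coef n)%:~R / n%:R `^ s * v n) * cos (2 * pi * n%:R * x + phi).
have mP : measurable_fun D P by exact: measurable_cos_sum.
have PB x : `|P x| <= B.
  rewrite /P; apply: le_trans (vB M x phi (leq_maxl _ _)); rewrite le_eqVlt; apply/orP; left.
  by apply/eqP; congr (`|_|); apply: eq_bigr => n _; ring.
(* Half of [eta] from [n <= N1], where [(1 - v n)^2 <= e], plus [8 eta] from the tail, where
   [(1 - v n)^2 <= 1]. *)
have SP : (\int[mu]_(x in D) (((cos_partial s phi N x - P x) ^+ 2)%R)%:E <= (9 / 2 * eta)%:E)%E.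
  pose c n := (euler_coef n)%:~R / n%:R `^ s * (1 - v n) : R.
  have -> : (\int[mu]_(x in D) (((cos_partial s phi N x - P x) ^+ 2)%R)%:E =
      \int[mu]_(x in D) (((\sum_(1 <= n < N.+1) c n * cos (2 * pi * n%:R * x + phi)) ^+ 2)%R)%:E)%E.
    apply: eq_integral => x _; congr ((_ ^+ 2)%:E); rewrite /cos_partial /P -sumrB.
    by apply: eq_bigr => n _; rewrite /c; ring.
  rewrite parseval_cos lee_fin (@big_cat_nat _ _ _ N1.+1) //=.
  have h1 : \sum_(1 <= n < N1.+1) c n ^+ 2 <= eta.
    apply: le_trans (_ : _ <= e * T1) _.
      rewrite /T1 /T mulr_sumr big_nat [leRHS]big_nat; apply: ler_sum => n /andP[n0 nN].
      rewrite /c exprMn mulrC ler_wpM2r ?sqr_ge0 //.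
      have /andP[vn0 vn1] := v01 n n0.
      have := v1 n; rewrite n0 -ltnS nN => /(_ isT) vn.
      have e1 : e <= 1 by rewrite ge_min lexx.
      by nra.
    apply: le_trans (_ : _ <= eta / (T1 + 1) * T1) _.
      by rewrite ler_wpM2r ?Tge0 // ge_min lexx orbT.
    rewrite mulrAC ler_pdivrMr // ler_pM2l //; lra.
  have h2 : \sum_(N1.+1 <= n < N.+1) c n ^+ 2 <= 8 * eta.
    apply: le_trans (tailT N N1N); rewrite /T big_nat [leRHS]big_nat.
    apply: ler_sum => n /andP[n1 _]; have n0 : (0 < n)%N by apply: leq_trans n1.
    have /andP[vn0 vn1] := v01 n n0.
    rewrite /c exprMn -[leRHS]mulr1 ler_wpM2l ?sqr_ge0 //; nra.
  by lra.
pose E1 := D `&` [set x | (1 / 2 < `|u x - cos_partial s phi N x|)%R].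
pose E2 := D `&` [set x | (1 / 2 < `|cos_partial s phi N x - P x|)%R].
have m1 : measurable_fun D (fun x => u x - cos_partial s phi N x) by exact: measurable_funB.
have m2 : measurable_fun D (fun x => cos_partial s phi N x - P x) by exact: measurable_funB.
apply: (@le_trans _ _ (mu (E1 `|` E2))).
  apply: le_measure; rewrite ?inE; [exact: mabs|apply: measurableU; exact: mabs|].
  move=> x [Dx /= ux]; have [h|h] := ltP (1 / 2) `|u x - cos_partial s phi N x|; first by left.
  right; split => //=; have := PB x.
  have t1 := ler_normD (u x - cos_partial s phi N x) (cos_partial s phi N x - P x + P x).
  have t2 := ler_normD (cos_partial s phi N x - P x) (P x).
  rewrite (_ : _ + (_ - _ + _) = u x) in t1; last by ring.
  by lra.
apply: le_trans (measureU2 _ _ _) _; [exact: mabs|exact: mabs|].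
rewrite (_ : 22 * eta = 4 * eta + 4 * (9 / 2 * eta)); last by field.
rewrite -[leRHS]/(4%:E * eta%:E + 4%:E * (9 / 2 * eta)%:E)%E; apply: leeD.
  by apply: le_trans (sqr_chebyshev m1) _; apply: lee_wpmul2l => //; apply: HN1.
by apply: le_trans (sqr_chebyshev m2) _; apply: lee_wpmul2l.
Qed.

End EssentialBound.

(** * From essential boundedness to the weak-type estimate *)

Theorem theorem2 (R : realType) (s : R) (u v : R -> R) :
  1 / 4 < s -> s < 1 / 2 ->
  measurable_fun (@unit_interval R) u ->
  measurable_fun (@unit_interval R) v ->
  (fun N : nat => \int[lebesgue_measure]_(x in (@unit_interval R))
      (((u x - m_re_partial s N x) ^+ 2)%R)%:E)%E @ \oo --> 0%E ->
  (fun N : nat => \int[lebesgue_measure]_(x in (@unit_interval R))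
      (((v x - m_im_partial s N x) ^+ 2)%R)%:E)%E @ \oo --> 0%E ->
  exists c : R, forall alpha : R, 0 < alpha ->
    (lebesgue_measure [set x : R | (0 <= x <= 1)%R /\
                        (alpha < Num.sqrt (u x ^+ 2 + v x ^+ 2))%R]
     <= (c * alpha `^ (- (2 / (1 - 2 * s))))%:E)%E.
Proof.
move=> s4 s2 mu_ mv cu cv; have s42 : 1 / 4 < s < 1 / 2 by rewrite s4.
have reE N x : m_re_partial s N x = cos_partial s 0 N x.
  by apply: eq_bigr => n _; rewrite addr0; ring.
(* The phase [pi / 2] turns the cosine into minus the sine. *)
have imE N x : m_im_partial s N x = cos_partial s (pi / 2) N x.
  by apply: eq_bigr => n _; rewrite cosDpihalf; ring.
have [A A0 nullA] : exists2 B : R, 0 <= B &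
    lebesgue_measure (@unit_interval R `&` [set x | B < `|u x|]) = 0%E.
  apply: ess_bounded s42 mu_ _; apply: cvg_trans cu; apply: near_eq_cvg; apply: nearW => N.
  by apply: eq_integral => x _; rewrite reE.
have [B B0 nullB] : exists2 B : R, 0 <= B &
    lebesgue_measure (@unit_interval R `&` [set x | B < `|v x|]) = 0%E.
  apply: ess_bounded s42 mv _; apply: cvg_trans cv; apply: near_eq_cvg; apply: nearW => N.
  by apply: eq_integral => x _; rewrite imE.
have mD := @measurable_unit_interval R.
pose q := 2 / (1 - 2 * s); have q0 : 0 < q by rewrite divr_gt0 //; lra.
pose b := A + B + 1; have b0 : 0 < b by rewrite /b; lra.
(* For [alpha >= b] the set is null; for [alpha < b] its measure is at most [1 <= (b / alpha)^q]. *)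
exists (b `^ q) => alpha alpha0; rewrite -/q.
have mE : measurable (@unit_interval R `&` [set x | alpha < Num.sqrt (u x ^+ 2 + v x ^+ 2)]).
  have mw : measurable_fun (@unit_interval R) (fun x => u x ^+ 2 + v x ^+ 2).
    by apply: measurable_funD; exact: measurable_funX.
  have := mw mD `](alpha ^+ 2), +oo[%classic (measurable_itv _); congr (measurable (_ `&` _)).
  apply/seteqP; split => x /=; rewrite in_itv /= andbT => h.
    by rewrite -[alpha]ger0_norm ?(ltW alpha0) // -sqrtr_sqr ltr_sqrt // (le_lt_trans _ h) ?sqr_ge0.
  rewrite -[_ + _]sqr_sqrtr ?addr_ge0 ?sqr_ge0 //.
  by rewrite ltrXn2r ?nnegrE ?sqrtr_ge0 ?(ltW alpha0).
rewrite [X in lebesgue_measure X](_ : _ =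
  @unit_interval R `&` [set x | alpha < Num.sqrt (u x ^+ 2 + v x ^+ 2)]) //.
have [ba|ab] := leP b alpha.
  apply: (@le_trans _ _ 0%E); last by rewrite lee_fin mulr_ge0 ?powR_ge0.
  have mA := measurable_normr_gt A mu_; have mB := measurable_normr_gt B mv.
  apply: (@le_trans _ _ (lebesgue_measure ((@unit_interval R `&` [set x | A < `|u x|]) `|`
                          (@unit_interval R `&` [set x | B < `|v x|])))).
    apply: le_measure; rewrite ?inE; [exact: mE|exact: measurableU|].
    (* If [|u| <= A] and [|v| <= B], the modulus is at most [A + B], which is less than
       [b <= alpha]. *)
    move=> x [Dx /= ax]; have [uA|uA] := ltP A `|u x|; first by left.
    right; split => //=; rewrite ltNge; apply/negP => vB.
    have : Num.sqrt (u x ^+ 2 + v x ^+ 2) <= A + B.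
      rewrite -[A + B]ger0_norm ?addr_ge0 // -sqrtr_sqr ler_wsqrtr //.
      rewrite -(real_normK (num_real (u x))) -(real_normK (num_real (v x))).
      have := normr_ge0 (u x); have := normr_ge0 (v x); nra.
    by move: ax ba; rewrite /b; lra.
  by apply: le_trans (measureU2 (@lebesgue_measure R) mA mB) _; rewrite [X in (X + _)%E]nullA [X in (_ + X)%E]nullB adde0.
apply: (@le_trans _ _ 1%E).
  by rewrite -(measure_unit_interval R); apply: le_measure; rewrite ?inE //; exact: subIsetl.
rewrite lee_fin powRN ler_pdivlMr ?powR_gt0 // mul1r.
by rewrite ge0_ler_powR ?nnegrE ?(ltW q0) ?(ltW alpha0) ?(ltW b0) ?(ltW ab).
Qed.
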